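(* Let $d\ge2$, $n\ge d+2$ and $D=\binom{d+2}{2}$. Let $\mathbf w=(w_1,\dots,w_D)$ have rational rank $D$ and describe a point in $\mathbb C^D$ that is a point of $L_{d,d+2}$. Suppose there is a configuration $\mathbf p$ of $n$ points in $\mathbb R^d$ that is generic (or simply such that $l(\mathbf p)$ is generic in $L_{d,n}$) and $D$ non-negative rational functionals $\gamma_1,\dots,\gamma_D$ such that $w_i=\langle\gamma_i,\mathbf p\rangle$ for all $i$. Then there must be a $(d+2)$-point subconfiguration $\mathbf p_T$ of $\mathbf p$ such that $\mathbf w=s\cdot l(\mathbf p_T)$, where $s$ is an unknown positive scale factor. The data $\mathbf w$ determines this $\mathbf p_T$ up to a similarity transform.
   Context: For a positive integer $n$ let $N=\binom n2$ and index the coordinates of $\mathbb C^N$ by pairs $ij$ ($1\le i<j\le n$) in a fixed order. For a complex configuration $\mathbf p=(\mathbf p_1,\dots,\mathbf p_n)$ of points in $\mathbb C^d$ put $m_{ij}(\mathbf p)=\sum_{k=1}^d(\mathbf p_i^k-\mathbf p_j^k)^2$ (no conjugation). $M_{d,n}\subset\mathbb C^N$ is the set of all vectors $(m_{ij}(\mathbf p))_{ij}$ and $L_{d,n}$ is its preimage under coordinate-wise squaring. For $d\ge2$, $n\ge d+2$, $L_{d,n}$ is an irreducible variety defined over $\mathbb Q$; a point of it is generic if its coordinates satisfy no polynomial equation with rational coefficients other than those satisfied on all of $L_{d,n}$. A configuration in $\mathbb R^d$ is generic if its $dn$ coordinates satisfy no non-trivial polynomial equation with rational coefficients. For a real configuration,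 $l(\mathbf p)=(|\mathbf p_i-\mathbf p_j|)_{ij}$ is the vector of Euclidean edge lengths. A functional $\gamma=(\gamma^{ij})$ acts by $\langle\gamma,\mathbf p\rangle=\sum_{i<j}\gamma^{ij}|\mathbf p_i-\mathbf p_j|$; it is a non-negative rational functional if all $\gamma^{ij}$ are non-negative rationals. A $(d+2)$-point subconfiguration is $\mathbf p_T=(\mathbf p_{i_1},\dots,\mathbf p_{i_{d+2}})$ for an ordered sequence $T=(i_1,\dots,i_{d+2})$ of distinct indices; $l(\mathbf p_T)\in\mathbb R^D$ is its edge length vector, using the order of $T$. The rational rank of a finite sequence of complex numbers is the size of a maximal subset that is linearly independent over $\mathbb Q$. *)

(* Defs.v *)
From HB Require Import structures.
From mathcomp Require Import all_boot all_order all_algebra.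
From mathcomp Require Import boolp reals complex mpoly.

Set Implicit Arguments.
Unset Strict Implicit.
Unset Printing Implicit Defensive.

Import Order.TTheory GRing.Theory Num.Theory.
Local Open Scope ring_scope.
Local Open Scope complex_scope.

Definition pairs (n : nat) : {set 'I_n * 'I_n} :=
  [set e : 'I_n * 'I_n | (e.1 < e.2)%N].

Lemma card_pairs (n : nat) : #|pairs n| = 'C(n, 2).
Proof.
rewrite -bin2_sum big_mkord -sum1_card.
under eq_bigl => e do rewrite inE.
rewrite -(pair_big_dep xpredT (fun i j : 'I_n => (i < j)%N) (fun _ _ => 1%N)) /=.
rewrite (exchange_big_dep xpredT) //=; apply: eq_bigr => j _.
rewrite (big_ord_narrow (F := fun=> 1%N) (ltnW (ltn_ord j))).
by rewrite sum1_card card_ord.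
Qed.

(* The fixed order on the coordinates of C^N is the one given by enum. *)
Definition pair_of (n : nat) (k : 'I_'C(n, 2)) : 'I_n * 'I_n :=
  enum_val (cast_ord (esym (card_pairs n)) k).

(* The rows of a matrix are the points of a configuration.  Over R[i] this is
   the bilinear square, without conjugation. *)
Definition sqlengths (K : comPzRingType) (n d : nat) (p : 'M[K]_(n, d)) :
    'rV[K]_('C(n, 2)) :=
  \row_e \sum_(k < d) (p (pair_of e).1 k - p (pair_of e).2 k) ^+ 2.

Definition lengths (R : realType) (n d : nat) (p : 'M[R]_(n, d)) :
    'rV[R]_('C(n, 2)) :=
  map_mx Num.sqrt (sqlengths p).

Definition M_variety (R : realType) (d n : nat) (x : 'rV[R[i]]_('C(n, 2))) :
    Prop :=
  exists p : 'M[R[i]]_(n, d), x = sqlengths p.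

Definition L_variety (R : realType) (d n : nat) (x : 'rV[R[i]]_('C(n, 2))) :
    Prop :=
  M_variety d (map_mx (fun z => z ^+ 2) x).

Definition rat_eval (F : fieldType) (N : nat) (f : {mpoly rat[N]})
    (x : 'rV[F]_N) : F :=
  (map_mpoly ratr f).@[fun k => x 0 k].

Definition generic_in_L (R : realType) (d n : nat)
    (x : 'rV[R[i]]_('C(n, 2))) : Prop :=
  L_variety d x /\
  forall f : {mpoly rat['C(n, 2)]}, rat_eval f x = 0 ->
    forall y : 'rV[R[i]]_('C(n, 2)), L_variety d y -> rat_eval f y = 0.

Definition generic_config (R : realType) (n d : nat) (p : 'M[R]_(n, d)) :
    Prop :=
  forall f : {mpoly rat[n * d]}, f != 0 -> rat_eval f (mxvec p) != 0.

Definition rat_functional (R : realType) (n d : nat)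
    (g : 'rV[rat]_('C(n, 2))) (p : 'M[R]_(n, d)) : R :=
  \sum_e ratr (g 0 e) * lengths p 0 e.

(* Independence of the subfamily indexed by A; repeated entries of a sequence
   are dependent, so maximal index sets and maximal subsets have equal size. *)
Definition rat_independent (F : fieldType) (m : nat) (w : 'rV[F]_m)
    (A : {set 'I_m}) : Prop :=
  forall c : 'I_m -> rat, \sum_(i in A) ratr (c i) * w 0 i = 0 ->
    forall i, i \in A -> c i = 0.

Definition rational_rank (F : fieldType) (m : nat) (w : 'rV[F]_m) : nat :=
  \max_(A : {set 'I_m} | `[< rat_independent w A >]) #|A|.

(* Orientation-reversing similarities are allowed. *)
Definition similar_configs (R : realType) (n d : nat) (p q : 'M[R]_(n, d)) : Prop :=
  exists (s : R) (A : 'M[R]_d) (t : 'rV[R]_d),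
    [/\ 0 < s, A *m A^T = 1%:M &
        forall i, row i q = s *: (row i p *m A) + t].

Definition scaled_lengths (R : realType) (n d : nat)
    (w : 'rV[R[i]]_('C(n, 2))) (p : 'M[R]_(n, d)) : Prop :=
  exists2 s : R, 0 < s & w = map_mx (real_complex R) (s *: lengths p).

(* Main.v *)
(** Index the entries of w by the edges of K_(d+2) and let E be the matrix of the
    functionals, so that w = E l(p), and let f(w) be the Gram determinant of the
    squares of w. Then f o E vanishes at l(p), and by genericity at every sign
    change of every l(q): for generic p this uses that no product of distinct
    lengths |p_i - p_j| lies in Q(p), because each squared length has a simple zero
    away from the zeros of the others, so that signs can be flipped one at a time
    by Galois conjugation over Q(p). Hence each parity component of f o E is a polynomial in the
    squared lengths that vanishes on squared lengths of configurations in R^d.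

    Near the squared lengths of a configuration on a line, such a polynomial
    vanishes to order at least d, since no nonzero polynomial of degree < d
    vanishes on all sums of d - 1 collinear squared length vectors. As E is onto,
    f vanishes to order d at w0 = E |xi_i - xi_j|, which forces the Gram matrix of
    w0^2 to have vanishing principal 2-minors: by Heron's formula, for all xi on a
    line, the three entries of w0 on a triangle 0jk are those of a degenerate
    triangle. A nonnegative combination of the |xi_i - xi_j| is determined by its
    values on cuts, and comparing cuts along flags shows that the three rows of E
    on a triangle are a common multiple of the edges of a triangle of K_n. These
    triangles fit together to a relabelling T. *)

Require Import Defs.
From mathcomp Require Import all_boot all_order all_algebra.
From mathcomp Require Import reals complex.
From mathcomp Require Import perm boolp mpoly ring lra.

Set Implicit Arguments.
Unset Strict Implicit.
Unset Printing Implicit Defensive.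

Import Order.TTheory GRing.Theory Num.Theory.
Local Open Scope ring_scope.
Local Open Scope complex_scope.

(** * Edges, Gram matrices and congruence *)

Lemma pair_of_lt n (e : 'I_'C(n, 2)) : ((pair_of e).1 < (pair_of e).2)%N.
Proof. by have := enum_valP (cast_ord (esym (card_pairs n)) e); rewrite inE. Qed.

Lemma pair_of_neq n (e : 'I_'C(n, 2)) : (pair_of e).1 != (pair_of e).2.
Proof. by rewrite -val_eqE; have := pair_of_lt e; rewrite ltn_neqAle => /andP[]. Qed.

Lemma pair_of_inj n : injective (@pair_of n).
Proof. by move=> e e' /enum_val_inj /cast_ord_inj. Qed.

Lemma pair_of_surj n (u v : 'I_n) : (u < v)%N -> exists e, pair_of e = (u, v).
Proof.
move=> uv; have uvP : (u, v) \in pairs n by rewrite inE.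
exists (cast_ord (card_pairs n) (enum_rank_in uvP (u, v))).
by rewrite /pair_of cast_ordK enum_rankK_in.
Qed.

Definition joins n (u v : 'I_n) (e : 'I_'C(n, 2)) :=
  (pair_of e == (u, v)) || (pair_of e == (v, u)).

Lemma joins_sym n (u v : 'I_n) : joins u v =1 joins v u.
Proof. by move=> e; rewrite /joins orbC. Qed.

Lemma joins_pair_of n (e : 'I_'C(n, 2)) :
  joins (pair_of e).1 (pair_of e).2 =1 pred1 e.
Proof.
move=> e'; rewrite /joins -surjective_pairing (inj_eq (@pair_of_inj n)) /=.
case: eqP => //= _; apply/negP => /eqP eq_e; have := pair_of_lt e.
by have := pair_of_lt e'; rewrite eq_e /= => /ltnW; rewrite leqNgt => /negPf->.
Qed.

(** Stating this through [pred1] lets the sum in [edge_at] collapse to a single term. *)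
Lemma ex_joins n (u v : 'I_n) : u != v -> exists e, joins u v =1 pred1 e.
Proof.
rewrite -val_eqE neq_ltn => /orP[] /pair_of_surj[e ee]; exists e => e'.
  by rewrite -joins_pair_of ee.
by rewrite joins_sym -joins_pair_of ee.
Qed.

(* The coordinate of x at the unordered pair uv, and 0 when u = v. *)
Definition edge_at (V : nmodType) n (x : 'rV[V]_'C(n, 2)) (u v : 'I_n) : V :=
  \sum_(e | joins u v e) x 0 e.

Section EdgeAt.
Variables (V : zmodType) (n : nat).
Implicit Types (x y : 'rV[V]_'C(n, 2)) (u v : 'I_n).

Lemma edge_at_joins x u v e : joins u v =1 pred1 e -> edge_at x u v = x 0 e.
Proof. by move=> je; rewrite /edge_at (eq_bigl _ _ je) big_pred1_eq. Qed.

Lemma edge_at_pair_of x e : edge_at x (pair_of e).1 (pair_of e).2 = x 0 e.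
Proof. exact/edge_at_joins/joins_pair_of. Qed.

Lemma edge_at_sym x u v : edge_at x u v = edge_at x v u.
Proof. by apply: eq_bigl; apply: joins_sym. Qed.

Lemma edge_at_diag x u : edge_at x u u = 0.
Proof.
rewrite /edge_at big_pred0 // => e; apply/negP; rewrite /joins orbb => /eqP ee.
by have := pair_of_lt e; rewrite ee ltnn.
Qed.

Lemma edge_atD x y u v : edge_at (x + y) u v = edge_at x u v + edge_at y u v.
Proof. by rewrite -big_split; apply: eq_bigr => e _; rewrite mxE. Qed.

Lemma edge_at_ext (f : 'I_n -> 'I_n -> V) x u v :
  (forall u v, f u v = f v u) -> (forall u, f u u = 0) ->
  (forall e, x 0 e = f (pair_of e).1 (pair_of e).2) -> edge_at x u v = f u v.
Proof.
move=> fC f0 xf; case: (eqVneq u v) => [->|]; first by rewrite edge_at_diag f0.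
rewrite -val_eqE neq_ltn => /orP[] /pair_of_surj[e ee].
  by have := edge_at_pair_of x e; rewrite xf ee.
by have := edge_at_pair_of x e; rewrite edge_at_sym fC xf ee.
Qed.

End EdgeAt.

Lemma map_edge_at (V W : zmodType) (f : {additive V -> W}) n
    (x : 'rV[V]_'C(n, 2)) u v : edge_at (map_mx f x) u v = f (edge_at x u v).
Proof. by rewrite raddf_sum; apply: eq_bigr => e _; rewrite mxE. Qed.

Lemma edge_at_sqlengths (K : comPzRingType) n d (p : 'M[K]_(n, d)) u v :
  edge_at (sqlengths p) u v = \sum_k (p u k - p v k) ^+ 2.
Proof.
apply: (@edge_at_ext _ _ (fun u v => \sum_k (p u k - p v k) ^+ 2)) => {u v}.
- by move=> u v; apply: eq_bigr => k _; ring.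
- by move=> u; apply: big1 => k _; rewrite subrr expr0n.
- by move=> e; rewrite mxE.
Qed.

(* Twice the Gram matrix of the vectors p_(a+1) - p_0 when Y = sqlengths p. *)
Definition gram (V : zmodType) n (Y : 'rV[V]_'C(n.+1, 2)) : 'M[V]_n :=
  \matrix_(a, b) (edge_at Y ord0 (lift ord0 a) + edge_at Y ord0 (lift ord0 b)
                  - edge_at Y (lift ord0 a) (lift ord0 b)).

Lemma map_gram (V W : zmodType) (f : {additive V -> W}) n
  (Y : 'rV[V]_'C(n.+1, 2)) : map_mx f (gram Y) = gram (map_mx f Y).
Proof. by apply/matrixP=> a b; rewrite !mxE !map_edge_at raddfB raddfD. Qed.

Definition from_base (V : zmodType) n d (p : 'M[V]_(n.+1, d)) : 'M[V]_(n, d) :=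
  \matrix_(a, k) (p (lift ord0 a) k - p ord0 k).

Lemma gram_sqlengths (K : comPzRingType) n d (p : 'M[K]_(n.+1, d)) :
  gram (sqlengths p) = (from_base p *m (from_base p)^T) *+ 2.
Proof.
apply/matrixP => a b; rewrite mulmxnE !mxE !edge_at_sqlengths -big_split -sumrB /=.
by rewrite -sumrMnl; apply: eq_bigr => k _; rewrite !mxE; ring.
Qed.

(** The Gram matrix has size d + 1 but factors through the d coordinates of the points, so its rank
    is at most d. *)
Lemma det_gram_L_variety (R : realType) d (w : 'rV[R[i]]_'C(d.+2, 2)) :
  L_variety d w -> \det (gram (map_mx (fun z => z ^+ 2) w)) = 0.
Proof.
case=> p ->; rewrite gram_sqlengths; apply/eqP/negPn/negP => nz.
have : (\rank (from_base p *m (from_base p)^T *+ 2) <= d)%N.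
  rewrite -scaler_nat scalemxAl; apply: leq_trans (mxrankM_maxr _ _) _.
  exact: rank_leq_row.
by rewrite mxrank_unit ?ltnn // unitmxE unitfE.
Qed.

Section Similarity.
Variable R : realFieldType.

Definition dot d (u v : 'rV[R]_d) : R := (u *m v^T) 0 0.

Lemma dotC d (u v : 'rV[R]_d) : dot u v = dot v u.
Proof. by rewrite /dot -[u *m _]trmxK trmx_mul trmxK mxE. Qed.

Lemma dotBr d (u v w : 'rV[R]_d) : dot u (v - w) = dot u v - dot u w.
Proof. by rewrite /dot linearB /= mulmxBr !mxE. Qed.

Lemma dotBl d (u v w : 'rV[R]_d) : dot (v - w) u = dot v u - dot w u.
Proof. by rewrite dotC dotBr ![dot u _]dotC. Qed.

Lemma dot_eq0 d (u : 'rV[R]_d) : (dot u u == 0) = (u == 0).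
Proof.
apply/eqP/eqP => [uu0|->]; last by rewrite /dot mul0mx mxE.
apply/rowP => k; rewrite mxE; apply/eqP; rewrite -sqrf_eq0; apply/eqP.
move: uu0; rewrite /dot mxE => /psumr_eq0P uu0.
by rewrite expr2 -[RHS](uu0 _ k) ?mxE // => i _; rewrite mxE -expr2 sqr_ge0.
Qed.

Lemma dot_row d m (P : 'M[R]_(m, d)) i j : dot (row i P) (row j P) = (P *m P^T) i j.
Proof. by rewrite /dot !mxE; apply: eq_bigr => k _; rewrite !mxE. Qed.

Lemma dot_orthogonal d (A : 'M[R]_d) (u v : 'rV[R]_d) :
  A *m A^T = 1%:M -> dot (u *m A) (v *m A) = dot u v.
Proof. by move=> oA; rewrite /dot trmx_mul mulmxA -(mulmxA u) oA mulmx1. Qed.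

Definition householder d (c : 'rV[R]_d) : 'M[R]_d :=
  1%:M - (2 / dot c c) *: (c^T *m c).

Lemma mul_householder d (c x : 'rV[R]_d) :
  x *m householder c = x - (2 * dot x c / dot c c) *: c.
Proof.
rewrite mulmxBr mulmx1 -scalemxAr mulmxA [x *m c^T]mx11_scalar mul_scalar_mx.
by rewrite scalerA -/(dot x c) mulrAC.
Qed.

Lemma tr_householder d (c : 'rV[R]_d) : (householder c)^T = householder c.
Proof. by rewrite linearB /= trmx1 linearZ /= trmx_mul trmxK. Qed.

Lemma householder_orthogonal d (c : 'rV[R]_d) :
  c != 0 -> householder c *m (householder c)^T = 1%:M.
Proof.
rewrite -dot_eq0 tr_householder => c0; apply/row_matrixP => i.
rewrite !rowE mulmxA mulmx1; set x := delta_mx _ _.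
have Hc : c *m householder c = - c.
  by rewrite mul_householder mulfK // scaler_nat mulr2n opprD addrA subrr sub0r.
rewrite (mul_householder c x) mulmxBl -scalemxAl Hc mul_householder scalerN opprK.
by rewrite subrK.
Qed.

(** Rows are matched one at a time. If u is the current image of the next row of [P] and v its
    target, they have equal norm, so the reflection along u - v sends u to v. It fixes the rows of
    [Q] already reached, because these have the same product with u as with v. *)
Lemma orthogonal_of_gram m d (P Q : 'M[R]_(m, d)) :
  P *m P^T = Q *m Q^T -> exists2 A : 'M[R]_d, A *m A^T = 1%:M & Q = P *m A.
Proof.
move=> PQ; suff H k : exists2 A : 'M[R]_d, A *m A^T = 1%:M &
    forall i : 'I_m, (i < k)%N -> row i Q = row i P *m A.
  have [A oA QA] := H m; exists A => //; apply/row_matrixP => i.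
  by rewrite row_mul QA.
have dPQ i j : dot (row i P) (row j P) = dot (row i Q) (row j Q).
  by rewrite !dot_row PQ.
elim: k => [|k [A oA QA]]; first by exists 1%:M => //; rewrite trmx1 mulmx1.
case: (ltnP k m) => [km|mk]; last first.
  by exists A => // i _; apply: QA; apply: leq_trans (ltn_ord i) mk.
set K := Ordinal km; set u := row K P *m A; set v := row K Q.
have [uv|] := eqVneq (u - v) 0.
  exists A => // i; rewrite ltnS leq_eqVlt => /orP[/eqP ik|/QA//].
  by rewrite (_ : i = K) -/v; [apply/esym/subr0_eq | apply: val_inj].
move=> nz; exists (A *m householder (u - v)).
  by rewrite trmx_mul mulmxA -(mulmxA A) householder_orthogonal // mulmx1.
have duu : dot u u = dot v v by rewrite dot_orthogonal // dPQ.
have cc : dot (u - v) (u - v) = 2 * dot u (u - v).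
  by rewrite !dotBr !dotBl -duu (dotC v u); ring.
move=> i; rewrite ltnS leq_eqVlt => /orP[/eqP ik|ik].
  rewrite (_ : i = K) -/v; last exact: val_inj.
  rewrite mulmxA -/u mul_householder cc divff -?cc ?dot_eq0 //.
  by rewrite scale1r subKr.
have Qu : dot (row i Q) u = dot (row i Q) v by rewrite QA // dot_orthogonal // dPQ QA.
by rewrite mulmxA -QA // mul_householder dotBr Qu subrr mulr0 mul0r scale0r subr0.
Qed.

End Similarity.

Lemma congruent_of_sqlengths (R : realFieldType) n d (p q : 'M[R]_(n.+1, d)) :
  sqlengths p = sqlengths q ->
  exists (A : 'M[R]_d) (t : 'rV[R]_d),
    A *m A^T = 1%:M /\ forall i, row i q = row i p *m A + t.
Proof.
move=> pq; have : from_base p *m (from_base p)^T = from_base q *m (from_base q)^T.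
  have n2 : (2 : R) != 0 by rewrite pnatr_eq0.
  by apply: (scalerI n2); rewrite !scaler_nat -!gram_sqlengths pq.
case/orthogonal_of_gram => A oA qA.
exists A, (row ord0 q - row ord0 p *m A); split=> // i.
case: (unliftP ord0 i) => [j|] ->; last by rewrite addrC subrK.
have fb (r : 'M[R]_(n.+1, d)) : row (lift ord0 j) r = row j (from_base r) + row ord0 r.
  by apply/rowP => k; rewrite !mxE subrK.
rewrite !fb qA row_mul mulmxDl -addrA; congr (_ + _).
by rewrite addrCA subrr addr0.
Qed.

Lemma sqlengthsZ (K : comPzRingType) n d c (p : 'M[K]_(n, d)) :
  sqlengths (c *: p) = c ^+ 2 *: sqlengths p.
Proof.
apply/rowP => e; rewrite !mxE mulr_sumr; apply: eq_bigr => k _.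
by rewrite !mxE; ring.
Qed.

Lemma sqlengths_ge0 (R : realDomainType) n d (p : 'M[R]_(n, d)) e :
  0 <= sqlengths p 0 e.
Proof. by rewrite mxE sumr_ge0 // => k _; rewrite sqr_ge0. Qed.

Lemma sqr_lengths (R : realType) n d (p : 'M[R]_(n, d)) e :
  lengths p 0 e ^+ 2 = sqlengths p 0 e.
Proof. by rewrite mxE sqr_sqrtr // sqlengths_ge0. Qed.

Lemma similar_of_lengths (R : realType) n d (p q : 'M[R]_(n.+1, d)) c :
  0 < c -> lengths q = c *: lengths p -> similar_configs p q.
Proof.
move=> c0 qp; have : sqlengths (c *: p) = sqlengths q.
  apply/rowP => e; rewrite sqlengthsZ -[RHS]sqr_lengths qp [LHS]mxE [in RHS]mxE exprMn.
  by rewrite sqr_lengths.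
case/congruent_of_sqlengths => A [t [oA qA]]; exists c, A, t; split=> // i.
by rewrite qA linearZ /= -scalemxAl.
Qed.

(** * Polynomials vanishing on squared lengths *)

Section DifferenceDegree.
Variables (V : zmodType) (R : comNzRingType).
Implicit Types (f g : V -> R).

(* Polynomial functions of degree at most k, in Frechet's sense. *)
Fixpoint fdeg k f : Prop :=
  if k is k'.+1 then forall a, fdeg k' (fun x => f (x + a) - f x)
  else forall x a, f (x + a) = f x.

Lemma eq_fdeg k f g : f =1 g -> fdeg k f -> fdeg k g.
Proof.
elim: k f g => [|k IHk] f g fg /= Hf; first by move=> x a; rewrite -!fg.
by move=> a; apply: IHk (Hf a) => x; rewrite !fg.
Qed.

Lemma fdeg0 k : fdeg k (fun=> 0).
Proof.
elim: k => [|k IHk] //= a.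
by apply: eq_fdeg IHk => x; rewrite subrr.
Qed.

Lemma fdegS k f : fdeg k f -> fdeg k.+1 f.
Proof.
elim: k f => [|k IHk] f Hf a; last exact: IHk (Hf a).
by move=> x b /=; rewrite !Hf !subrr.
Qed.

Lemma fdeg_leq k l f : (k <= l)%N -> fdeg k f -> fdeg l f.
Proof.
move=> /subnK <-; elim: (l - k)%N => [|m IHm] // Hf; exact/fdegS/IHm.
Qed.

Lemma fdegD k f g : fdeg k f -> fdeg k g -> fdeg k (fun x => f x + g x).
Proof.
elim: k f g => [|k IHk] f g /= Hf Hg; first by move=> x a; rewrite Hf Hg.
move=> a; apply: eq_fdeg (IHk _ _ (Hf a) (Hg a)) => x; ring.
Qed.

Lemma fdegMl k f c : fdeg k f -> fdeg k (fun x => c * f x).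
Proof.
elim: k f => [|k IHk] f /= Hf; first by move=> x a; rewrite Hf.
move=> a; apply: eq_fdeg (IHk _ (Hf a)) => x; ring.
Qed.

Lemma fdeg_shift k f b : fdeg k f -> fdeg k (fun x => f (x + b)).
Proof.
elim: k f => [|k IHk] f /= Hf; first by move=> x a; rewrite !Hf.
by move=> a; apply: eq_fdeg (IHk _ (Hf a)) => x; rewrite addrAC.
Qed.

(** The increment of h f by a is h times the increment of f plus h(a) times a translate of f. *)
Lemma fdeg_mul_additive k f h :
  {morph h : x y / x + y} -> fdeg k f -> fdeg k.+1 (fun x => h x * f x).
Proof.
move=> hD; elim: k f => [|k IHk] f Hf a.
  move=> x b; rewrite !hD -!(addrA x) !Hf; ring.
have := fdegD (IHk _ (Hf a)) (fdegMl (h a) (fdeg_shift a Hf)).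
by apply: eq_fdeg => x; rewrite hD; ring.
Qed.

Lemma fdeg_sum k (I : Type) (r : seq I) (P : pred I) (F : I -> V -> R) :
  (forall i, P i -> fdeg k (F i)) -> fdeg k (fun x => \sum_(i <- r | P i) F i x).
Proof.
move=> HF; elim: r => [|i r IHr].
  by apply: eq_fdeg (fdeg0 k) => x; rewrite big_nil.
case Pi: (P i); last by apply: eq_fdeg IHr => x; rewrite big_cons Pi.
by apply: eq_fdeg (fdegD (HF i Pi) IHr) => x; rewrite big_cons Pi.
Qed.

End DifferenceDegree.

Section Vanishing.
Variables (R : rcfType) (n : nat).
Local Notation N := 'C(n, 2).

Lemma sqlengths_row_mx (K : comPzRingType) d1 d2 (p : 'M[K]_(n, d1))
    (q : 'M[K]_(n, d2)) : sqlengths (row_mx p q) = sqlengths p + sqlengths q.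
Proof.
apply/rowP => e; rewrite !mxE big_split_ord /=; congr (_ + _);
  by apply: eq_bigr => k _; rewrite ?(row_mxEl, row_mxEr).
Qed.

(* Rank one vectors span: three cuts isolate an edge. *)
Lemma delta_of_cuts (i j : 'I_n) (e : 'I_N) (r : R) : pair_of e = (i, j) ->
  let ind (P : pred 'I_n) : 'cV[R]_n := \col_u (r * (P u)%:R) in
  (2 * r ^+ 2) *: delta_mx 0 e = sqlengths (ind (pred1 i)) + sqlengths (ind (pred1 j))
     - sqlengths (ind (pred2 i j)).
Proof.
move=> ee /=; have ij := pair_of_neq e; rewrite ee /= in ij.
apply/rowP => e'; rewrite !mxE !big_ord1 !mxE /=.
have -> : (e' == e) = (pair_of e' == (i, j)) by rewrite -ee (inj_eq (@pair_of_inj _)).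
have : pair_of e' != (j, i).
  apply/negP => /eqP ee'; have := pair_of_lt e; have := pair_of_lt e'.
  by rewrite ee ee' /= => /ltnW; rewrite leqNgt => /negPf ->.
have := pair_of_neq e'; case: (pair_of e') => k l /=; rewrite !xpair_eqE.
case: (eqVneq k i) => [->|ki]; case: (eqVneq k j) => [?|kj]; subst;
case: (eqVneq l i) => [?|li]; case: (eqVneq l j) => [?|lj]; subst;
  rewrite ?eqxx ?(negPf ij) //= => *; try ring; try (by move: ij; rewrite eqxx).
Qed.

(** Induction on the degree. The increment of f along the squared lengths of a collinear
    configuration xi has lower degree and vanishes on squared lengths in one dimension less, since
    adding squared lengths amounts to concatenating coordinates. So f is invariant under these
    translations; they generate all translations, and f is constant. *)
Lemma fdeg_vanish k (f : 'rV[R]_N -> R) : fdeg k f ->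
  (forall q : 'M[R]_(n, k), f (sqlengths q) = 0) -> forall x, f x = 0.
Proof.
elim: k f => [|k IHk] f /= Hf f0 x.
  by rewrite -[x]add0r Hf -(Hf 0 (sqlengths (0 : 'M[R]_(n, 0)))) add0r f0.
have inv (xi : 'cV[R]_n) y : f (y + sqlengths xi) = f y.
  apply/eqP; rewrite -subr_eq0; apply/eqP; move: y; apply: IHk => // q.
  rewrite (addrC (sqlengths q)) -sqlengths_row_mx f0.
  (* A zero coordinate appended to [q] leaves its squared lengths unchanged, so f vanishes there
     too. *)
  have : f (sqlengths (0 : 'cV_n) + sqlengths q) = 0 by rewrite -sqlengths_row_mx f0.
  rewrite [sqlengths 0](_ : _ = 0) ?add0r => [->|]; first by rewrite oppr0.
  by apply/rowP => e; rewrite !mxE big_ord1 !mxE subrr expr0n.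
have invN (xi : 'cV[R]_n) y : f (y - sqlengths xi) = f y.
  by rewrite -(inv xi (y - _)) subrK.
(* The square root brings c to the form 2 r^2 of [delta_of_cuts]; negative c are handled by the
   inverse translation. *)
have invp c e y : 0 <= c -> f (y + c *: delta_mx 0 e) = f y.
  move=> c0; have -> : c = 2 * Num.sqrt (c / 2) ^+ 2.
    by rewrite sqr_sqrtr ?divr_ge0 // mulrC divfK ?pnatr_eq0.
  case ee: (pair_of e) => [i j].
  by rewrite (delta_of_cuts _ ee) !addrA invN !inv.
have inve c e y : f (y + c *: delta_mx 0 e) = f y.
  case: (leP 0 c) => [|c0]; first exact: invp.
  by rewrite -[in RHS](subrK (- (c *: delta_mx 0 e)) y) opprK -scaleNr (invp (- c)) ?oppr_ge0
      1?ltW.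
have -> : f x = f 0.
  rewrite [x]row_sum_delta; elim: (index_enum _) => [|e r IHr]; first by rewrite big_nil.
  by rewrite big_cons addrC inve.
rewrite -(f0 0); congr f.
by apply/rowP => e; rewrite !mxE big1 // => i _; rewrite !mxE subrr expr0n.
Qed.

End Vanishing.

(** * Order of vanishing along polynomial curves *)

Section OrderOfVanishing.
Variables (R : rcfType) (N : nat).
Implicit Types (psi : {mpoly R[N]}).

Definition shift_mpoly (a : 'I_N -> R) psi : {mpoly R[N]} :=
  psi \mPo [tuple 'X_e + (a e)%:MP | e < N].

Lemma mmap_shift_mpoly (v : 'I_N -> {poly R}) a psi :
  mmap polyC v (shift_mpoly a psi) = mmap polyC (fun e => (a e)%:P + v e) psi.
Proof.
rewrite [shift_mpoly _ _]/shift_mpoly /comp_mpoly [X in mmap _ _ X]/mmap [RHS]/mmap rmorph_sum.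
apply: eq_bigr => m _; rewrite rmorphM /= mmapC /mmap1 rmorph_prod; congr (_ * _).
apply: eq_bigr => e _; rewrite rmorphXn /= tnth_mktuple; congr (_ ^+ _).
by rewrite rmorphD /= mmapX mmap1U mmapC addrC.
Qed.

Lemma horner_mmap (v : 'I_N -> {poly R}) psi t :
  (mmap polyC v psi).[t] = psi.@[fun e => (v e).[t]].
Proof.
rewrite /meval /mmap -horner_evalE rmorph_sum; apply: eq_bigr => m _.
rewrite rmorphM /= horner_evalE hornerC /mmap1 rmorph_prod; congr (_ * _).
by apply: eq_bigr => e _; rewrite rmorphXn.
Qed.

Lemma mmap_polyX_homog (m : 'I_N -> {poly R}) psi :
  mmap polyC (fun e => 'X * m e) psi =
    \sum_(k < msize psi) 'X^k * mmap polyC m (pihomog mdeg k psi).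
Proof.
rewrite {1}(@pihomog_partitionE N _ mdeg (msize psi) psi) ?mfsize_mdeg //.
rewrite rmorph_sum; apply: eq_bigr => k _; rewrite pihomogE !rmorph_sum mulr_sumr.
apply: eq_bigr => mm /eqP mk; rewrite /= !mmapZ !mmapX mulrCA; congr (_ * _).
have -> : k = (\sum_e mm e)%N :> nat by rewrite -mk; exact: mdegE.
rewrite /mmap1 -prodrXr -big_split; apply: eq_bigr => e _.
by rewrite exprMn.
Qed.

(** A monomial of degree k is a product of k coordinates, each of which is additive. *)
Lemma fdeg_homog k psi : fdeg k (fun b : 'rV[R]_N => (pihomog mdeg k psi).@[b 0]).
Proof.
pose F m (b : 'rV[R]_N) := psi@_m * \prod_e b 0 e ^+ m e.
apply: (@eq_fdeg _ _ _ (fun b => \sum_(m <- msupp psi | mdeg m == k) F m b)).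
  move=> b; rewrite pihomogE rmorph_sum; apply: eq_bigr => m _.
  by rewrite /= mevalZ mevalX.
apply: fdeg_sum => m /eqP <-; apply: fdegMl; rewrite mdegE.
elim: (index_enum _) => [|e r IHr].
  by apply: (@eq_fdeg _ _ _ (fun=> 1)) => [b|]; rewrite !big_nil.
rewrite big_cons.
apply: (@eq_fdeg 'rV[R]_N R _ (fun b => b 0 e ^+ m e * \prod_(i <- r) b 0 i ^+ m i)) => [b|].
  by rewrite big_cons.
elim: (m e) => [|c IHc]; first by apply: eq_fdeg IHr => b; rewrite mul1r.
have eD : {morph (fun b : 'rV[R]_N => b 0 e) : x y / x + y} by move=> x y; rewrite mxE.
by apply: eq_fdeg (fdeg_mul_additive eD IHc) => b; rewrite exprS mulrA.
Qed.

End OrderOfVanishing.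

Lemma poly_nneg_eq0 (R : realDomainType) (P : {poly R}) :
  (forall t, 0 <= t -> P.[t] = 0) -> P = 0.
Proof.
move=> P0; apply: (@roots_geq_poly_eq0 _ _ [seq i%:R | i <- iota 0 (size P)]).
- by apply/allP => _ /mapP[i _ ->]; rewrite rootE P0 ?ler0n.
- by rewrite map_inj_uniq ?iota_uniq //; apply: mulrIn; rewrite oner_eq0.
- by rewrite size_map size_iota.
Qed.

(* Each homogeneous component psi_k of psi at a vanishes on the squared lengths
   of configurations in R^d, hence identically for k <= d. *)
Lemma dvdp_order (R : rcfType) n d (psi : {mpoly R['C(n, 2)]})
    (a : 'I_'C(n, 2) -> R) (m : 'I_'C(n, 2) -> {poly R}) :
  (forall (q : 'M[R]_(n, d)) t, 0 <= t ->
     psi.@[fun e => a e + t * sqlengths q 0 e] = 0) ->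
  'X^(d.+1) %| mmap polyC (fun e => (a e)%:P + 'X * m e) psi.
Proof.
move=> psi0; rewrite -mmap_shift_mpoly; set psi' := shift_mpoly a psi.
have comp0 (k : 'I_(msize psi')) (q : 'M[R]_(n, d)) :
    (pihomog mdeg k psi').@[sqlengths q 0] = 0.
  (* Along the ray in the direction of the squared lengths of [q], the polynomial vanishes for all t
     >= 0; its coefficient of t^k is the value of the component of degree k. *)
  have P0 : mmap polyC (fun e => 'X * (sqlengths q 0 e)%:P) psi' = 0.
    apply: poly_nneg_eq0 => t t0; rewrite mmap_shift_mpoly horner_mmap.
    by rewrite -[RHS](psi0 q t) //; apply: meval_eq => e; rewrite !hornerE.
  have homC l : mmap polyC (fun e => (sqlengths q 0 e)%:P) (pihomog mdeg l psi')
      = ((pihomog mdeg l psi').@[sqlengths q 0])%:P.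
    rewrite /meval /mmap rmorph_sum; apply: eq_bigr => mm _.
    rewrite rmorphM /mmap1 rmorph_prod; congr (_ * _).
    by apply: eq_bigr => e _; rewrite rmorphXn.
  move: P0; rewrite mmap_polyX_homog; under eq_bigr do rewrite homC mulrC mul_polyC.
  move=> /(congr1 (fun P : {poly R} => P`_k)); rewrite coef0 coef_sum.
  rewrite (bigD1 k) //= coefZ coefXn eqxx mulr1 big1 ?addr0 // => l lk.
  by rewrite coefZ coefXn val_eqE eq_sym (negPf lk) mulr0.
rewrite mmap_polyX_homog; elim/big_rec: _ => [|k P _ dP]; first exact: dvdp0.
rewrite dvdp_addr //; have [kd|dk] := leqP k d; last first.
  by apply: dvdp_mulr; apply: dvdp_exp2l.
rewrite (_ : mmap _ _ _ = 0) ?mulr0 ?dvdp0 //.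
apply: poly_nneg_eq0 => t _; rewrite horner_mmap.
have := fdeg_vanish (fdeg_leq kd (fdeg_homog k psi')) (comp0 k) (\row_e (m e).[t]).
by move=> <-; apply: meval_eq => e; rewrite mxE.
Qed.

(** Successive approximation of the root of r^2 + c X with constant term r. If q(0) is the lowest
    coefficient of the error, subtracting c' X^(k+1) with c' = q(0) / (2 r) cancels it. *)
Lemma truncated_sqrt (K : numFieldType) (r c : K) k : r != 0 ->
  exists z : {poly K}, 'X^k %| (r%:P + 'X * z) ^+ 2 - ((r ^+ 2)%:P + 'X * c%:P).
Proof.
move=> r0; suff [z [q ze]] : exists z q : {poly K},
    (r%:P + 'X * z) ^+ 2 - ((r ^+ 2)%:P + 'X * c%:P) = 'X^(k.+1) * q.
  by exists z; rewrite ze dvdp_mulr // dvdp_exp2l.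
elim: k => [|k [z [q ze]]].
  by exists 0, (- c%:P); rewrite mulr0 addr0 -rmorphXn /=; ring.
have /factor_theorem[u uq] : root (q - q.[0]%:P) 0 by rewrite rootE !hornerE subrr.
pose c' := (q.[0] / (2 * r))%:P.
have c'E : 2 * c' * r%:P = q.[0]%:P.
  rewrite -[2](rmorph_nat polyC) -!rmorphM /= mulrAC.
  by rewrite mulrC divfK // mulf_neq0 ?pnatr_eq0.
exists (z - 'X^k * c'), (u - 2 * c' * z + 'X^k * c' ^+ 2).
move: uq; rewrite subr0 => uq.
transitivity ('X^(k.+1) * q - 'X^(k.+1) * (2 * c' * r%:P)
   - 'X^(k.+2) * (2 * c' * z - 'X^k * c' ^+ 2)).
  by rewrite -ze !exprS; ring.
by rewrite c'E -mulrBr uq !exprS; ring.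
Qed.

Lemma prod_linear_poly (K : comNzRingType) (I : Type) (r : seq I) (x c : I -> K) :
  let P := \prod_(i <- r) ((x i)%:P + 'X * (c i)%:P) in
  (size P <= (size r).+1)%N /\ P`_(size r) = \prod_(i <- r) c i.
Proof.
elim: r => [|i r [IHs IHc]] /=; first by rewrite !big_nil size_poly1 coefC.
rewrite !big_cons; split.
  apply: leq_trans (size_polyMleq _ _) _.
  apply: (@leq_trans (2 + (size r).+1).-1) => //; rewrite -!subn1 leq_sub2r //.
  apply: leq_add => //.
  apply: leq_trans (size_polyD _ _) _; rewrite geq_max size_polyC.
  rewrite (leq_trans (leq_b1 _)) //= mulrC mul_polyC.
  by apply: leq_trans (size_scale_leq _ _) _; rewrite size_polyX.
rewrite mulrDl coefD mulrC -mulrA coefXM /= [_ * _%:P]mulrC !coefCM IHc.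
by rewrite nth_default ?mulr0 ?add0r // mulrC.
Qed.

(** Only the rows in [J] involve X, and only linearly, so the coefficient of X^|J| takes the X part
    of each of these rows and the constant part of the others. *)
Lemma coef_det_diag (K : comNzRingType) m (G : 'M[K]_m) (J : {set 'I_m}) :
  (\det (\matrix_(a, b) ((G a b)%:P + 'X * ((a == b) && (a \in J))%:R%:P)))`_#|J|
    = \det (\matrix_(a, b) if a \in J then (a == b)%:R else G a b).
Proof.
rewrite /determinant coef_sum; apply: eq_bigr => s _.
rewrite -(rmorph_sign polyC) coefCM; congr (_ * _).
rewrite (bigID (mem J)) [in RHS](bigID (mem J)) /=.
under [X in _ * X]eq_bigr => a /negPf aJ do rewrite mxE aJ andbF mulr0 addr0.
under [X in _ = _ * X]eq_bigr => a /negPf aJ do rewrite mxE aJ.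
rewrite -rmorph_prod mulrC coefCM mulrC; congr (_ * _).
under eq_bigr => a _ do rewrite mxE.
under [RHS]eq_bigr => a aJ do rewrite mxE aJ.
rewrite cardE -big_enum /=; have [_ ->] := prod_linear_poly (enum J)
  (fun a => G a ((s : 'S_m) a)) (fun a => ((a == (s : 'S_m) a) && (a \in J))%:R).
by rewrite big_enum /=; apply: eq_bigr => a ->; rewrite andbT.
Qed.

(** The coefficient of X^(d-1) is a determinant whose rows outside {i, j} are those of the identity.
    As it vanishes there is a kernel vector; it is supported on {i, j} and so lies in the kernel of
    the 2 by 2 block. *)
Lemma minor_of_dvdp_det (K : fieldType) d (G : 'M[K]_d.+1) (i j : 'I_d.+1) :
  i != j ->
  'X^d %| \det (\matrix_(a, b) ((G a b)%:P + 'X * ((a == b) && (a \in ~: [set i; j]))%:R%:P)) ->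
  G i i * G j j = G i j * G j i.
Proof.
move=> ij /dvdpP[Q detQ]; set J := ~: [set i; j].
have cJ : #|J| = d.-1 by rewrite cardsCs setCK cards2 ij card_ord subSS subn1.
have d0 : (0 < d)%N.
  by case: d i j ij {G Q detQ J cJ} => // i j; rewrite (ord1 i) (ord1 j) eqxx.
have := coef_det_diag G J; rewrite detQ coefMXn cJ prednK // leqnn.
move=> /esym/eqP; rewrite -det_tr => /det0P[v v0].
move=> /rowP vN.
have vJ a : a \in J -> v 0 a = 0.
  move=> aJ; have := vN a; rewrite !mxE (bigD1 a) //= !mxE aJ eqxx mulr1.
  by rewrite big1 ?addr0 // => b ba; rewrite !mxE aJ (eq_sym a) (negPf ba) mulr0.
have vE a : a \notin J -> v 0 i * G a i + v 0 j * G a j = 0.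
  move=> aJ; have := vN a; rewrite !mxE (bigD1 i) // (bigD1 j) 1?eq_sym //=.
  rewrite !mxE (negPf aJ) addrA big1 ?addr0 // => b /andP[bi bj].
  by rewrite vJ ?mul0r // !inE negb_or bi bj.
have := vE i; have := vE j; rewrite !inE !eqxx orbT => /(_ isT) vj /(_ isT) vi.
have det_v k : k \in [set i; j] -> v 0 k * (G i i * G j j - G i j * G j i) = 0.
  rewrite !inE => /orP[] /eqP->.
    transitivity (G j j * (v 0 i * G i i + v 0 j * G i j)
      - G i j * (v 0 i * G j i + v 0 j * G j j)); first by ring.
    by rewrite vi vj !mulr0 subrr.
  transitivity (G i i * (v 0 i * G j i + v 0 j * G j j)
      - G j i * (v 0 i * G i i + v 0 j * G i j)); first by ring.
  by rewrite vi vj !mulr0 subrr.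
have /rV0Pn[k vk] := v0.
have kJ : k \in [set i; j].
  by rewrite -[_ \in _]negbK -in_setC; apply: contra vk => /vJ ->.
by move: (det_v k kJ) => /eqP; rewrite mulf_eq0 (negPf vk) subr_eq0 => /eqP.
Qed.

(** * Degenerate triangles *)

Definition sqr_mx (K : pzSemiRingType) m n (A : 'M[K]_(m, n)) := map_mx (fun z => z ^+ 2) A.

Lemma dvdp_detB (K : fieldType) m (A B : 'M[{poly K}]_m) (p : {poly K}) :
  (forall a b, p %| A a b - B a b) -> p %| \det A - \det B.
Proof.
move=> pAB; rewrite /determinant -sumrB; elim/big_rec: _ => [|s P _ dP]; first exact: dvdp0.
rewrite dvdp_addr // -mulrBr dvdp_mull //.
elim: (index_enum _) => [|a r IHr]; first by rewrite !big_nil subrr dvdp0.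
rewrite !big_cons; move: IHr (pAB a (s a)); move: (A a _) (B a _) => x y.
move: (\prod_(i <- r) A i _) (\prod_(i <- r) B i _) => u v duv dxy.
have -> : x * u - y * v = (x - y) * u + y * (u - v) by ring.
by apply: dvdp_add; [apply: dvdp_mulr | apply: dvdp_mull].
Qed.

Lemma gramD (V : zmodType) n (X Y : 'rV[V]_'C(n.+1, 2)) : gram (X + Y) = gram X + gram Y.
Proof.
apply/matrixP => a b; rewrite !mxE !edge_atD opprD.
by rewrite (addrACA (edge_at X _ _)) [LHS]addrACA.
Qed.

Lemma gramZ (K : pzRingType) n c (X : 'rV[K]_'C(n.+1, 2)) : gram (c *: X) = c *: gram X.
Proof.
have edZ u v : edge_at (c *: X) u v = c * edge_at X u v.
  by rewrite /edge_at mulr_sumr; apply: eq_bigr => e _; rewrite mxE.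
by apply/matrixP => a b; rewrite !mxE !edZ mulrBr mulrDr.
Qed.

Lemma dvdp_gram (K : fieldType) n (X : 'rV[{poly K}]_'C(n.+1, 2)) p a b :
  (forall e, p %| X 0 e) -> p %| gram X a b.
Proof.
move=> pX; have edX u v : p %| edge_at X u v.
  by rewrite /edge_at; elim/big_rec: _ => [|e P _ dP]; [exact: dvdp0 | exact: dvdp_add].
by rewrite mxE dvdp_sub // dvdp_add.
Qed.

(** Since [E] is onto, there is a polynomial curve [x] starting at [x0] along which the squares of E
    x are w0^2 + X B modulo X^(d+1), where the Gram matrix of [B] is the diagonal projection onto
    the indices other than j and k. By [dvdp_order] each [psi S] vanishes to order d + 1 along the
    curve, hence so does the determinant of gram (w0^2) + X gram B, and [minor_of_dvdp_det]
    applies. *)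
Lemma gram_minor (R : rcfType) d n (E : 'M[R]_('C(d.+3, 2), 'C(n, 2)))
    (F : 'M[R]_('C(n, 2), 'C(d.+3, 2)))
    (I : finType) (mon : I -> 'rV[{poly R}]_'C(n, 2) -> {poly R})
    (psi : I -> {mpoly R['C(n, 2)]}) (xi : 'cV[R]_n) (x0 : 'rV[R]_'C(n, 2))
    (j k : 'I_d.+2) :
  (forall x : 'rV[{poly R}]_'C(n, 2),
     \det (gram (sqr_mx (x *m (map_mx polyC E)^T))) =
     \sum_S mon S x * mmap polyC (sqr_mx x 0) (psi S)) ->
  (forall S (q : 'M[R]_(n, d.+1)), (forall e, 0 < sqlengths q 0 e) ->
     (psi S).@[sqlengths q 0] = 0) ->
  E *m F = 1%:M -> (forall e, 0 < sqlengths xi 0 e) -> sqr_mx x0 = sqlengths xi ->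
  (forall i, (x0 *m E^T) 0 i != 0) -> j != k ->
  let G := gram (sqr_mx (x0 *m E^T)) in G j j * G k k = G j k * G k j.
Proof.
move=> detE psi0 EF xi0 x0E; set w0 := x0 *m E^T => w00 jk G.
pose J := ~: [set j; k].
(* For edge values wt u + wt v with weight 0 at the base point, off-diagonal Gram entries cancel and
   the diagonal ones are twice the weight; hence the halves. *)
pose wt (u : 'I_d.+3) : R := if unlift ord0 u is Some a then (a \in J)%:R / 2 else 0.
pose f u v := if u == v then 0 else wt u + wt v.
pose B : 'rV[R]_'C(d.+3, 2) := \row_i f (pair_of i).1 (pair_of i).2.
have edgeB u v : edge_at B u v = f u v.
  apply: edge_at_ext => [{}u {}v|{}u|e]; last by rewrite mxE.
    by rewrite /f eq_sym addrC.
  by rewrite /f eqxx.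
have gramB a b : gram B a b = ((a == b) && (a \in J))%:R.
  rewrite mxE !edgeB /f (inj_eq (@lift_inj _ _)) !(negPf (neq_lift _ _)) /wt unlift_none !liftK.
  by case: (eqVneq a b) => [->|_] /=; field.
have /choice[z zE] i := truncated_sqrt (B 0 i) d.+1 (w00 i).
pose y := (\row_i z i) *m (map_mx polyC F)^T.
pose x := map_mx polyC x0 + 'X *: y.
have xE : x *m (map_mx polyC E)^T = map_mx polyC w0 + 'X *: \row_i z i.
  rewrite mulmxDl -scalemxAl -mulmxA -trmx_mul -map_mxM EF map_mx1 trmx1 mulmx1.
  by rewrite map_trmx -map_mxM.
have : 'X^(d.+1) %| \det (gram (sqr_mx (x *m (map_mx polyC E)^T))).
  rewrite detE; elim/big_rec: _ => [|S P _ dP]; first exact: dvdp0.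
  rewrite dvdp_addr // dvdp_mull //.
  (* The squares of [x] are put in the form a + X m that [dvdp_order] expects, with a the squared
     lengths of [xi]. *)
  have -> : mmap polyC (sqr_mx x 0) (psi S) = mmap polyC (fun e =>
      (sqlengths xi 0 e)%:P + 'X * ((2 * x0 0 e)%:P * y 0 e + 'X * y 0 e ^+ 2)) (psi S).
    rewrite /mmap; apply: eq_bigr => m _; congr (_ * _); apply: mmap1_eq => e.
    rewrite -x0E !mxE rmorphXn rmorphM /=; ring.
  apply: dvdp_order => q t t0.
  (* Adding t times the squared lengths of [q] to those of [xi] amounts to appending the coordinates
     of sqrt(t) q to [xi], which uses one dimension more than [q] and keeps all squared lengths
     positive. *)
  have sq := sqlengths_row_mx xi (Num.sqrt t *: q).
  rewrite sqlengthsZ sqr_sqrtr // in sq.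
  have := psi0 S (row_mx xi (Num.sqrt t *: q)); rewrite sq => <- => [|e].
    by apply: meval_eq => e; rewrite [RHS]mxE [X in _ = _ + X]mxE.
  by rewrite mxE [X in _ < _ + X]mxE ltr_wpDr // mulr_ge0 // sqlengths_ge0.
rewrite xE => dvd1; apply: minor_of_dvdp_det jk _.
rewrite -(dvdp_subr _ dvd1); apply: dvdp_detB => a b.
set Y := sqr_mx _; set Z := map_mx polyC (sqr_mx w0) + 'X *: map_mx polyC B.
rewrite [X in _ - X](_ : _ = gram Z a b); last first.
  by rewrite gramD gramZ -!map_gram !mxE -gramB !mxE.
have -> : gram Y a b - gram Z a b = gram (Y - Z) a b.
  have -> : gram Y = gram (Y - Z) + gram Z by rewrite -gramD subrK.
  by rewrite [X in X - _]mxE addrK.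
apply: dvdp_gram => i; rewrite (_ : (Y - Z) 0 i = (((w0 0 i)%:P + 'X * z i) ^+ 2 -
  ((w0 0 i ^+ 2)%:P + 'X * (B 0 i)%:P))) //.
by rewrite /Y /Z /sqr_mx !mxE rmorphXn.
Qed.

(** * Sign changes *)

Lemma rat_evalE (F : fieldType) N (f : {mpoly rat[N]}) (x : 'rV[F]_N) :
  rat_eval f x = mmap ratr (x 0) f.
Proof.
rewrite /rat_eval /map_mpoly [X in meval _ X]/mmap rmorph_sum; apply: eq_bigr => m _.
by rewrite mmap1_id /= mevalM mevalC mevalX.
Qed.

Section Parity.
Variables (K : nzRingType) (N : nat).
Implicit Types (S : {set 'I_N}) (h : {mpoly K[N]}).

Definition odd_set (m : 'X_{1..N}) : {set 'I_N} := [set i | odd (m i)].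

(** A polynomial is the sum over S of X^S times a polynomial in the squared variables; this is that
    second factor. Rounding down the halved exponents removes X^S. *)
Definition parity_part S h : {mpoly K[N]} :=
  \sum_(m <- msupp h | odd_set m == S) h@_m *: 'X_[[multinom (m i)./2 | i < N]].

Lemma mmap_parity (L : comNzRingType) (f : {rmorphism K -> L}) (x : 'I_N -> L) h :
  mmap f x h =
  \sum_(S : {set 'I_N}) (\prod_(i in S) x i) * mmap f (fun i => x i ^+ 2) (parity_part S h).
Proof.
rewrite /mmap (partition_big odd_set predT) //=; apply: eq_bigr => S _.
rewrite -/(mmap _ _ _) rmorph_sum mulr_sumr; apply: eq_bigr => m /eqP <-.
rewrite /= mmapZ mmapX mulrCA; congr (_ * _).
rewrite /mmap1 [X in _ = X * _]big_mkcond -big_split; apply: eq_bigr => i _.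
rewrite /= mnmE inE -exprM mul2n -[in LHS](odd_double_half (m i)) exprD.
by case: odd.
Qed.

End Parity.

Section Signs.
Variables (K : numDomainType) (N : nat).
Implicit Types (f : {ffun 'I_N -> bool}) (S : {set 'I_N}).

(** Orthogonality of the characters of the group of sign vectors. *)
Lemma sum_sign_prod S S' : \sum_(f : {ffun 'I_N -> bool}) (\prod_(i in S) (-1) ^+ f i) *
    (\prod_(i in S') (-1) ^+ f i)
  = (2 ^+ N *+ (S == S') : K).
Proof.
transitivity (\sum_(f : {ffun 'I_N -> bool}) \prod_i (-1) ^+ (((i \in S) (+) (i \in S')) && f
    i) : K).
  apply: eq_bigr => f _; rewrite [X in X * _]big_mkcond [X in _ * X]big_mkcond -big_split.
  apply: eq_bigr => i _ /=; case: (i \in S); case: (i \in S'); case: (f i);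
    rewrite /= ?expr0 ?expr1 ?mulr1 ?mul1r ?mulrNN ?mulr1 //.
pose F (i : 'I_N) (b : bool) : K := (-1) ^+ (((i \in S) (+) (i \in S')) && b).
transitivity (\prod_i \sum_(b : bool) F i b); first by rewrite bigA_distr_bigA.
rewrite /F {F}.
have [<-|neSS'] := eqVneq S S'.
  rewrite (eq_bigr (fun=> 2)) ?prodr_const ?card_ord // => i _.
  by rewrite big_bool /= addbb /= expr0.
have /existsP[i neq_i] : [exists i, (i \in S) != (i \in S')].
  rewrite -negb_forall; apply: contra neSS' => /forallP SS'.
  by apply/eqP/setP => i; apply/eqP.
rewrite (bigD1 i) //= big_bool /=.
by move: neq_i; case: (i \in S); case: (i \in S') => //= _; rewrite expr1 expr0 addNr mul0r.
Qed.

Lemma sign_components (c : {set 'I_N} -> K) :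
  (forall f, \sum_(S : {set 'I_N}) (\prod_(i in S) (-1) ^+ f i) * c S = 0) -> forall S, c S = 0.
Proof.
move=> c0 S0; apply: (@mulfI _ (2 ^+ N)); first by rewrite expf_neq0 ?pnatr_eq0.
rewrite mulr0; transitivity (\sum_(f : {ffun 'I_N -> bool}) (\prod_(i in S0) (-1) ^+ f i) *
    \sum_(S : {set 'I_N}) (\prod_(i in S) (-1) ^+ f i) * c S); last first.
  by rewrite big1 // => f _; rewrite c0 mulr0.
under eq_bigr => f _ do rewrite mulr_sumr.
rewrite exchange_big (bigD1 S0) //=.
under eq_bigr => f _ do rewrite mulrA.
rewrite -mulr_suml sum_sign_prod eqxx mulr1n [X in _ + X]big1 ?addr0 // => S SS0.
under eq_bigr => f _ do rewrite mulrA.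
by rewrite -mulr_suml sum_sign_prod eq_sym (negPf SS0) mul0r.
Qed.

(** Inverting the character sum shows that each x^S times its parity part vanishes, and x^S is
    nonzero. *)
Lemma parity_part_eq0 (h : {mpoly rat[N]}) (x : 'I_N -> K) (ratK : {rmorphism rat -> K}) :
  (forall f, mmap ratK (fun i => (-1) ^+ f i * x i) h = 0) -> (forall i, x i != 0) ->
  forall S, mmap ratK (fun i => x i ^+ 2) (parity_part S h) = 0.
Proof.
move=> h0 x0 S; suff /eqP : (\prod_(i in S) x i) * mmap ratK (fun i => x i ^+ 2) (parity_part S
    h) = 0.
  rewrite mulf_eq0 => /orP[/prodf_eq0 [i _ /eqP xi]|/eqP//].
  by have := x0 i; rewrite xi eqxx.
move: S; apply: sign_components => f; rewrite -[RHS](h0 f) mmap_parity.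
apply: eq_bigr => S _; rewrite big_split /= mulrA; congr (_ * _).
rewrite /mmap; apply: eq_bigr => m _; congr (_ * _); apply: mmap1_eq => i.
by rewrite exprMn sqrr_sign mul1r.
Qed.

End Signs.

(** * Square roots over a field *)

Section Kummer.
Variable F : numFieldType.
Implicit Types (K : F -> Prop) (x y z : F).

(** A subfield is a predicate, so that towers of quadratic extensions stay inside the one field
    [F]. *)
Definition is_subfield K :=
  [/\ K 1, forall x y, K x -> K y -> K (x - y) & forall x y, K x -> K y -> K (x / y)].

Section Closure.
Variables (K : F -> Prop) (HK : is_subfield K).

Lemma subfield1 : K 1. Proof. by case: HK. Qed.
Lemma subfieldB x y : K x -> K y -> K (x - y). Proof. by case: HK => _ H _; apply: H. Qed.
Lemma subfield_div x y : K x -> K y -> K (x / y). Proof. by case: HK => _ _; apply. Qed.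
Lemma subfield0 : K 0. Proof. by rewrite -(subrr 1); apply: subfieldB; apply: subfield1. Qed.
Lemma subfieldN x : K x -> K (- x).
Proof. by rewrite -sub0r; apply: subfieldB subfield0. Qed.
Lemma subfieldD x y : K x -> K y -> K (x + y).
Proof. by move=> Kx Ky; rewrite -[y]opprK; apply/subfieldB/subfieldN. Qed.
Lemma subfieldV x : K x -> K x^-1.
Proof. by rewrite -[x^-1]mul1r; apply: subfield_div subfield1. Qed.
Lemma subfieldM x y : K x -> K y -> K (x * y).
Proof. by move=> Kx Ky; rewrite -[y]invrK; apply/subfield_div/subfieldV. Qed.
Lemma subfieldX x n : K x -> K (x ^+ n).
Proof.
move=> Kx; elim: n => [|n IHn]; first exact: subfield1.
by rewrite exprS; apply: subfieldM.
Qed.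
Lemma subfield_sum (I : eqType) (r : seq I) (P : pred I) (G : I -> F) :
  (forall i, i \in r -> P i -> K (G i)) -> K (\sum_(i <- r | P i) G i).
Proof.
move=> KG; rewrite big_seq_cond; elim/big_rec: _ => [|i z /andP[ir Pi]]; first exact: subfield0.
exact/subfieldD/KG.
Qed.
Lemma subfield_prod (I : eqType) (r : seq I) (P : pred I) (G : I -> F) :
  (forall i, i \in r -> P i -> K (G i)) -> K (\prod_(i <- r | P i) G i).
Proof.
move=> KG; rewrite big_seq_cond; elim/big_rec: _ => [|i z /andP[ir Pi]]; first exact: subfield1.
exact/subfieldM/KG.
Qed.
Lemma subfield_nat n : K n%:R.
Proof. by elim: n => [|n IHn]; [exact: subfield0 | rewrite -natr1; apply: subfieldD subfield1].
    Qed.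
Lemma subfield_rat q : K (ratr q).
Proof.
have Kz (m : int) : K m%:~R.
  by case: m => m; [exact: subfield_nat | rewrite NegzE rmorphN; exact/subfieldN/subfield_nat].
by rewrite /ratr; apply: subfield_div.
Qed.

End Closure.

Definition adjoin K x : F -> Prop := fun z => exists a b, [/\ K a, K b & z = a + b * x].

Lemma sub_adjoin K x z : is_subfield K -> K z -> adjoin K x z.
Proof. by move=> HK Kz; exists z, 0; rewrite mul0r addr0; split=> //; apply: (subfield0 HK). Qed.

Lemma mem_adjoin K x : is_subfield K -> adjoin K x x.
Proof.
by move=> HK; exists 0, 1; rewrite mul1r add0r; split; [apply: (subfield0 HK) | apply:
    (subfield1 HK) |].
Qed.

(** The inverse of a + b x is its conjugate divided by its norm. If the conjugate a - b x vanishes,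
    then a + b x = 2 a already lies in [K]. *)
Lemma adjoin_subfield K x : is_subfield K -> K (x ^+ 2) -> is_subfield (adjoin K x).
Proof.
move=> HK Kx2.
have adjM z t : adjoin K x z -> adjoin K x t -> adjoin K x (z * t).
  move=> [a [b [Ka Kb ->]]] [c [e [Kc Ke ->]]].
  exists (a * c + b * e * x ^+ 2), (a * e + b * c); split; last by ring.
    by apply: (subfieldD HK) => //; do !apply: (subfieldM HK) => //.
  by apply: (subfieldD HK) => //; apply: (subfieldM HK).
have adjV z : adjoin K x z -> adjoin K x z^-1.
  move=> [a [b [Ka Kb ->]]]; have [abx|abx] := eqVneq (a - b * x) 0.
    apply: sub_adjoin => //; apply: (subfieldV HK) => //.
    by rewrite -(subr0_eq abx); apply: (subfieldD HK).
  have [abx'|abx'] := eqVneq (a + b * x) 0.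
    by rewrite abx' invr0; apply: sub_adjoin => //; apply: (subfield0 HK).
  pose N := a ^+ 2 - b ^+ 2 * x ^+ 2; have NE : N = (a - b * x) * (a + b * x) by rewrite /N; ring.
  have KN : K N by apply: (subfieldB HK); [apply: (subfieldX HK) | apply: (subfieldM HK) => //;
      apply: (subfieldX HK)].
  exists (a / N), (- b / N); split; [exact: (subfield_div HK) | by apply: (subfield_div HK) KN;
      apply: (subfieldN HK) |].
  by rewrite NE; field; rewrite abx abx'.
split; first by apply: sub_adjoin => //; apply: (subfield1 HK).
  move=> _ _ [a [b [Ka Kb ->]]] [c [e [Kc Ke ->]]]; exists (a - c), (b - e).
  by split; [apply: (subfieldB HK) | apply: (subfieldB HK) | ring].
by move=> z t Az At; apply: adjM => //; apply: adjV.
Qed.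

Lemma foldl_adjoin_sub xs K : is_subfield K -> (forall x, x \in xs -> K (x ^+ 2)) ->
  [/\ is_subfield (foldl adjoin K xs), forall z, K z -> foldl adjoin K xs z &
      forall x, x \in xs -> foldl adjoin K xs x].
Proof.
elim: xs K => [|x xs IHxs] K HK Kxs //=.
have [|y yxs|HL sub mem] := IHxs (adjoin K x).
- by apply: adjoin_subfield => //; apply: Kxs; rewrite mem_head.
- by apply: sub_adjoin => //; apply: Kxs; rewrite inE yxs orbT.
split=> // [z Kz|y]; first exact/sub/sub_adjoin.
by rewrite inE => /orP[/eqP->|/mem//]; apply/sub/mem_adjoin.
Qed.

(* If z = a + b x and both z^2 and x^2 lie in K, then x is in K or a b = 0. *)
Lemma kummer xs K y : is_subfield K -> (forall x, x \in xs -> K (x ^+ 2)) -> K (y ^+ 2) ->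
  (forall m, size m = size xs -> ~ K (y * \prod_(x <- mask m xs) x)) ->
  ~ foldl adjoin K xs y.
Proof.
elim: xs K => [|x xs IHxs] K HK Kxs Ky yxs /=.
  by have := yxs [::] erefl; rewrite big_nil mulr1.
have Kx2 : K (x ^+ 2) by apply: Kxs; rewrite mem_head.
apply: IHxs.
- exact: adjoin_subfield.
- by move=> z zxs; apply: sub_adjoin => //; apply: Kxs; rewrite inE zxs orbT.
- exact: sub_adjoin.
move=> m sm [a [b [Ka Kb zE]]]; set z := y * _ in zE.
have Kz2 : K (z ^+ 2).
  rewrite exprMn -prodrXl; apply: (subfieldM HK) => //; apply: (subfield_prod HK) => // t
      /mem_mask txs _.
  by apply: Kxs; rewrite inE txs orbT.
have nz : ~ K z by apply: (yxs (false :: m)); rewrite /= sm.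
have nzx : ~ K (z * x).
  have := yxs (true :: m); rewrite /= big_cons sm => /(_ erefl).
  by rewrite mulrCA mulrC.
have [b0|b0] := eqVneq b 0; first by apply: nz; rewrite zE b0 mul0r addr0.
have [a0|a0] := eqVneq a 0.
  by apply: nzx; rewrite zE a0 add0r -mulrA -expr2; apply: (subfieldM HK).
have Kx : K x.
  have -> : x = (z ^+ 2 - a ^+ 2 - b ^+ 2 * x ^+ 2) / (2 * a * b).
    by rewrite zE; field; rewrite a0 b0.
  apply: (subfield_div HK) => //; last by do !apply: (subfieldM HK) => //; apply: (subfield_nat
      HK).
  apply: (subfieldB HK); last by apply: (subfieldM HK) => //; apply: (subfieldX HK).
  by apply: (subfieldB HK) => //; apply: (subfieldX HK).
by apply: nz; rewrite zE; apply: (subfieldD HK) => //; apply: (subfieldM HK).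
Qed.

(** Galois conjugation by hand: sorting by the parity of the exponent of x_e gives h(x) = A + B x_e
    with A and B in [K]. If B were nonzero, x_e = - A / B would lie in [K]; so B = 0 and the flip
    changes nothing. *)
Lemma flip_root K N (h : {mpoly rat[N]}) (x : 'I_N -> F) e :
  is_subfield K -> (forall i, i != e -> K (x i)) -> K (x e ^+ 2) -> ~ K (x e) ->
  mmap ratr x h = 0 -> mmap ratr (fun i => if i == e then - x i else x i) h = 0.
Proof.
move=> HK Kx Kxe nKxe.
pose rest (m : 'X_{1..N}) := ratr h@_m * \prod_(i | i != e) x i ^+ m i * (x e ^+ 2) ^+ (m e)./2.
pose A := \sum_(m <- msupp h | ~~ odd (m e)) rest m.
pose B := \sum_(m <- msupp h | odd (m e)) rest m.
have Krest m : K (rest m).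
  apply: (subfieldM HK); last exact: (subfieldX HK).
  apply: (subfieldM HK); first exact: (subfield_rat HK).
  by apply: (subfield_prod HK) => // i _ ie; apply: (subfieldX HK); apply: Kx.
have KA : K A by apply: (subfield_sum HK).
have KB : K B by apply: (subfield_sum HK).
have hE (s : bool) : mmap ratr (fun i => if i == e then (-1) ^+ s * x i else x i) h
    = A + (-1) ^+ s * B * x e.
  rewrite /mmap (bigID (fun m : 'X_{1..N} => odd (m e))) /= addrC; congr (_ + _).
    apply: eq_bigr => m /negPf em; rewrite /rest /mmap1 (bigD1 e) //= eqxx.
    rewrite -[RHS]mulrA; congr (_ * _); rewrite mulrC; congr (_ * _).
      by apply: eq_bigr => i /negPf ->.
    by rewrite -exprM mul2n -[in LHS](odd_double_half (m e)) em add0n exprMn -mul2n exprM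
        sqrr_sign expr1n mul1r.
  rewrite mulr_sumr mulr_suml; apply: eq_bigr => m em.
  rewrite /rest /mmap1 (bigD1 e) //= eqxx (eq_bigr (fun i => x i ^+ m i)); last by move=> i
      /negPf ->.
  rewrite -{1}(odd_double_half (m e)) em add1n exprS exprMn -mul2n ![(_ ^+ (2 * _))%R]exprM
      sqrr_sign expr1n.
  by ring.
move=> h0; have AB : A + B * x e = 0.
  rewrite -[RHS]h0; transitivity (A + (-1) ^+ false * B * x e); first by rewrite expr0 mul1r.
  rewrite -hE /mmap; apply: eq_bigr => m _; congr (_ * _); apply: mmap1_eq => i.
  by rewrite expr0 mul1r if_same.
have B0 : B = 0.
  apply/eqP/negPn/negP => B0; apply: nKxe.
  have -> : x e = - A / B by rewrite -[A](addrK (B * x e)) AB; field.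
  by apply: (subfield_div HK) => //; apply: (subfieldN HK).
have := hE true; rewrite -(AB) B0 !mulr0 !mul0r => <-.
rewrite /mmap; apply: eq_bigr => m _; congr (_ * _); apply: mmap1_eq => i.
by rewrite expr1 mulN1r.
Qed.

End Kummer.

(** * Lengths of a generic configuration over the field of its coordinates *)

Lemma simple_root_not_sqr_ratio (K : fieldType) (u a b : {poly K}) :
  u.[0] != 0 -> b != 0 -> 'X * u * b ^+ 2 <> a ^+ 2.
Proof.
move=> u0 b0 eq_ab.
have nu : u != 0 by apply: contraNneq u0 => ->; rewrite horner0.
have na : a != 0.
  by rewrite -sqrf_eq0 -eq_ab !mulf_neq0 ?polyX_eq0 ?expf_neq0.
(* The multiplicity of the root 0 is odd on the left and even on the right. *)
have := congr1 (mup 0) eq_ab; rewrite mupM ?mulf_neq0 ?polyX_eq0 ?expf_neq0 //.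
rewrite mupMl // -['X]subr0 (@mup_XsubCX _ 1 0 0) eqxx !expr2 !mupM //.
by move/(congr1 odd); rewrite !addnn add1n /= !odd_double.
Qed.

Lemma rmorph_mmap (A B : comNzRingType) (f : {rmorphism A -> B}) (g : {rmorphism rat -> A})
    N (v : 'I_N -> A) (p : {mpoly rat[N]}) :
  f (mmap g v p) = mmap (f \o g) (f \o v) p.
Proof.
rewrite /mmap rmorph_sum; apply: eq_bigr => m _; rewrite rmorphM /mmap1 rmorph_prod.
by congr (_ * _); apply: eq_bigr => i _; rewrite rmorphXn.
Qed.

Lemma map_sqlengths (K L : comPzRingType) (f : {rmorphism K -> L}) n d (p : 'M[K]_(n, d)) :
  map_mx f (sqlengths p) = sqlengths (map_mx f p).
Proof.
apply/rowP => e; rewrite !mxE rmorph_sum; apply: eq_bigr => k _.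
by rewrite rmorphXn rmorphB !mxE.
Qed.

Definition generic_matrix n d : 'M[{mpoly rat[n * d]}]_(n, d) :=
  \matrix_(u, k) 'X_(mxvec_index u k).

Lemma mmap_generic_matrix (K : comNzRingType) (f : {rmorphism rat -> K}) n d
    (p : 'M[K]_(n, d)) e :
  mmap f (mxvec p 0) (sqlengths (generic_matrix n d) 0 e) = sqlengths p 0 e.
Proof.
have -> : sqlengths p = map_mx (mmap f (mxvec p 0)) (sqlengths (generic_matrix n d)).
  rewrite map_sqlengths; congr sqlengths; apply/matrixP => u k.
  by rewrite !mxE /= mmapX mmap1U mxvecE.
by rewrite [RHS]mxE.
Qed.

Definition config_field (R : realType) n d (p : 'M[R]_(n, d)) (z : R) : Prop :=
  exists a b : {mpoly rat[n * d]}, rat_eval b (mxvec p) != 0 /\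
    z = rat_eval a (mxvec p) / rat_eval b (mxvec p).

Lemma config_field_subfield (R : realType) n d (p : 'M[R]_(n, d)) :
  is_subfield (config_field p).
Proof.
split.
- by exists 1, 1; rewrite !rat_evalE !rmorph1 divr1 oner_eq0.
- move=> _ _ [a [b [b0 ->]]] [a' [b' [b0' ->]]].
  exists (a * b' - a' * b), (b * b'); move: b0 b0'.
  rewrite !rat_evalE rmorphB !rmorphM /= => b0 b0'; rewrite mulf_neq0 //; split=> //.
  by field; rewrite b0 b0'.
- move=> _ _ [a [b [b0 ->]]] [a' [b' [b0' ->]]].
  have [a0|a0] := eqVneq (rat_eval a' (mxvec p)) 0.
    by exists 0, 1; rewrite a0 !rat_evalE rmorph0 rmorph1 oner_eq0 !mul0r invr0 mulr0.
  exists (a * b'), (b * a'); move: b0 b0' a0.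
  rewrite !rat_evalE !rmorphM /= => b0 b0' a0; rewrite mulf_neq0 //; split=> //.
  by field; rewrite b0 b0' a0.
Qed.

(* A configuration where the edge ij alone is isotropic. *)
Definition isotropic_edge (R : rcfType) n d (i j : 'I_n) : 'M[R[i]]_(n, d.+2) :=
  \matrix_(u, k) (if k == 0 then (if u == i then 1 else if u == j then 0 else u.+3%:R)
                  else if (k == 1) && (u == i) then 'i else 0).

(** The edge ij has squared length 1 + 'i^2 = 0. An edge from i to another point u has (u + 2)^2 - 1
    = (u + 1)(u + 3), which the offset 3 keeps nonzero; all remaining edges join distinct natural
    numbers on a line. *)
Lemma sqlengths_isotropic_edge (R : rcfType) n d (e e' : 'I_'C(n, 2)) :
  (sqlengths (isotropic_edge R d (pair_of e).1 (pair_of e).2) 0 e' == 0) = (e' == e).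
Proof.
have ij := pair_of_neq e; set i := (pair_of e).1; set j := (pair_of e).2.
rewrite -/i -/j in ij.
rewrite mxE big_ord_recl big_ord_recl big1 ?addr0; last first.
  by move=> k _; rewrite !mxE /= subrr expr0n.
rewrite !mxE /= -(inj_eq (@pair_of_inj _)) [pair_of e]surjective_pairing -/i -/j.
move: (pair_of_neq e') (pair_of_lt e') (pair_of_lt e).
case: (pair_of e') => k l /=; rewrite xpair_eqE -/i -/j.
have s0 a : (1 - a.+3%:R) ^+ 2 - 1 == 0 :> R[i] = false.
  have -> : (1 - a.+3%:R) ^+ 2 - 1 = (a.+1 * a.+3)%:R :> R[i].
    by rewrite natrM -!natr1; ring.
  by rewrite pnatr_eq0.
have [->|ki] := eqVneq k i; have [->|li] := eqVneq l i; rewrite ?eqxx //.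
- rewrite /= subr0 sqrCi; have [->|lj] := eqVneq l j => _ _ _.
    by rewrite subr0 expr1n subrr eqxx.
  by rewrite s0.
- rewrite sub0r sqrrN sqrCi; have [->|kj] := eqVneq k j => _ ji.
    by move=> /ltnW; rewrite leqNgt ji.
  by rewrite -sqrrN opprB s0.
rewrite subrr expr0n addr0 sqrf_eq0 subr_eq0.
have [->|kj] := eqVneq k j; have [->|lj] := eqVneq l j.
- by rewrite eqxx.
- by rewrite eq_sym pnatr_eq0.
- by rewrite pnatr_eq0.
by rewrite eqr_nat !eqSS => /negPf.
Qed.

(** If the product were a / b, the product of the squared lengths times b^2 would equal a^2 as
    polynomials in the coordinates. On a suitable complex line exactly one of these squared lengths
    has a root at 0, and that root is simple, which contradicts the parity of multiplicities. *)
Lemma lengths_prod_notin (R : realType) n d (p : 'M[R]_(n, d.+2)) e r :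
  generic_config p -> uniq (e :: r) ->
  ~ config_field p (\prod_(i <- e :: r) lengths p 0 i).
Proof.
move=> genp uer [a [b [b0 ab]]].
pose G := generic_matrix n d.+2.
pose f := \prod_(i <- e :: r) sqlengths G 0 i * b ^+ 2 - a ^+ 2.
(* The assumed equality, squared and cleared of its denominator, says that [f] vanishes at p;
   genericity makes this a polynomial identity. *)
have f0 : f = 0.
  apply/eqP/negPn/negP => /genp; rewrite /f rat_evalE rmorphB rmorphM !rmorphXn rmorph_prod /=.
  under eq_bigr => i _ do rewrite mmap_generic_matrix -sqr_lengths.
  move: b0 ab; rewrite !rat_evalE prodrXl => b0 ->.
  by rewrite -exprMn divfK // subrr eqxx.
pose i := (pair_of e).1; pose j := (pair_of e).2.
have [q1 q1_eq0 q1ij] : exists2 q : 'M[R[i]]_(n, d.+2),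
    forall e', (sqlengths q 0 e' == 0) = (e' == e) &
    forall k, q i k - q j k = if k == 0 then 1 else if k == 1 then 'i else 0.
  exists (isotropic_edge R d i j); first exact: sqlengths_isotropic_edge.
  move=> k; rewrite !mxE !eqxx (eq_sym j) (negPf (pair_of_neq e)) andbT andbF.
  by case: ifP => _; rewrite subr0.
have [pC pCE] : exists pC, pC = map_mx (real_complex R) p by exists (map_mx (real_complex R) p).
(* The line through [q1] at 0 and p at 1; at 0 only the squared length of [e] vanishes. *)
pose V : 'M[{poly R[i]}]_(n, d.+2) := map_mx polyC q1 + 'X *: map_mx polyC (pC - q1).
have V0 : map_mx (horner_eval 0) V = q1.
  by apply/matrixP => u k; rewrite !mxE /horner_eval !hornerE.
have V1 : map_mx (horner_eval 1) V = pC.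
  by apply/matrixP => u k; rewrite !mxE /horner_eval !hornerE /= addrAC subrr add0r.
have sqV e' t : (sqlengths V 0 e').[t] = sqlengths (map_mx (horner_eval t) V) 0 e'.
  by rewrite -map_sqlengths [RHS]mxE.
(* The derivative at 0 of the squared length of [e] along [V]: twice the bilinear product of the
   edge vectors of [q1] and p, the term in [q1] alone being zero by isotropy. It is nonzero because
   the first coordinates of the points i and j of p differ. *)
pose c := 2 * ((p i 0 - p j 0)%:C + 'i * (p i 1 - p j 1)%:C).
have c0 : c != 0.
  rewrite mulf_neq0 ?pnatr_eq0 // -complexiE eq_complex /= ?(mul0r, mul1r, mulr0, addr0, add0r,
      subr0).
  have pij : p i 0 - p j 0 != 0.
    pose z : 'I_d.+2 := 0; have := genp ('X_(mxvec_index i z) - 'X_(mxvec_index j z)).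
    rewrite rat_evalE rmorphB /= !mmapX !mmap1U !mxvecE; apply.
    apply/negP => /eqP /(congr1 (mmap idfun (mxvec (delta_mx i z : 'M[rat]_(n, d.+2)) 0))).
    rewrite rmorphB rmorph0 /= !mmapX !mmap1U !mxvecE !mxE !eqxx.
    by rewrite (eq_sym j) (negPf (pair_of_neq e)) /= subr0 => /eqP; rewrite oner_eq0.
  by rewrite (negPf pij).
have [u uE u0] : exists2 u, sqlengths V 0 e = 'X * u & u.[0] = c.
  pose D k := (pC i k - pC j k) - (q1 i k - q1 j k).
  have VE k : V i k - V j k = (q1 i k - q1 j k)%:P + 'X * (D k)%:P.
    by rewrite !mxE /D !rmorphB /=; ring.
  exists (\sum_k (2 * (q1 i k - q1 j k)%:P * (D k)%:P + 'X * (D k)%:P ^+ 2)).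
    rewrite mxE -/i -/j mulr_sumr.
    have sq0 : \sum_k (q1 i k - q1 j k) ^+ 2 = 0.
      by have := q1_eq0 e; rewrite eqxx mxE => /eqP.
    rewrite -[RHS]add0r.
    transitivity ((\sum_k (q1 i k - q1 j k) ^+ 2)%:P + \sum_k 'X * (2 * (q1 i k - q1 j k)%:P *
        (D k)%:P + 'X * (D k)%:P ^+ 2));
      last by rewrite sq0.
    rewrite rmorph_sum -big_split.
    by apply: eq_bigr => k _; rewrite VE rmorphXn /=; ring.
  rewrite horner_sum.
  have hE k : (2 * (q1 i k - q1 j k)%:P * (D k)%:P + 'X * (D k)%:P ^+ 2).[0]
     = 2 * (q1 i k - q1 j k) * (pC i k - pC j k) - 2 * (q1 i k - q1 j k) ^+ 2.
    rewrite -[2 in LHS](rmorph_nat polyC) !hornerE /= /D; ring.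
  under eq_bigr => k _ do rewrite hE.
  rewrite sumrB -[X in _ - X]mulr_sumr.
  have -> : \sum_k (q1 i k - q1 j k) ^+ 2 = 0.
    by have := q1_eq0 e; rewrite eqxx mxE => /eqP.
  rewrite mulr0 subr0 big_ord_recl big_ord_recl big1 ?addr0; last first.
    by move=> k _; rewrite q1ij /= mulr0 mul0r.
  rewrite !q1ij /= pCE !mxE /c -!rmorphB /= mulr1 mulrDr mulrA.
  have -> : lift ord0 ord0 = 1 :> 'I_d.+2 by apply: val_inj.
  by rewrite -complexiE.
pose ev := mmap (polyC \o ratr) (mxvec V 0).
have evE e' : ev (sqlengths G 0 e') = sqlengths V 0 e' by rewrite /ev mmap_generic_matrix.
have := congr1 ev f0; rewrite /ev rmorph0 rmorphB rmorphM !rmorphXn rmorph_prod.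
rewrite -/ev (eq_bigr _ (fun e' _ => evE e')) big_cons uE => /eqP.
rewrite subr_eq0 => /eqP; rewrite -(mulrA 'X).
apply: simple_root_not_sqr_ratio.
  rewrite hornerM u0 mulf_neq0 // -horner_evalE rmorph_prod prodf_seq_neq0.
  apply/allP => e' re' /=; rewrite horner_evalE sqV V0 q1_eq0.
  by apply: contraTneq uer => <-; rewrite /= re'.
(* At 1 the line passes through p, where [b] does not vanish, so [b] is nonzero along the line. *)
apply: contraNneq b0 => /(congr1 (horner_eval 1)); rewrite rmorph0 rmorph_mmap.
rewrite (_ : mmap _ _ b = (rat_eval b (mxvec p))%:C).
  by move/(congr1 (@complex.Re _)) => /= ->.
rewrite rat_evalE rmorph_mmap /mmap; apply: eq_bigr => m _; congr (_ * _).
  by rewrite /= /horner_eval hornerC fmorph_rat.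
apply: mmap1_eq => t; case/mxvec_indexP: t => x y.
rewrite /= !mxvecE; transitivity (pC x y); first by rewrite -V1 [RHS]mxE.
by rewrite pCE mxE.
Qed.

Lemma eq_mmap (K L : nzRingType) (f g : K -> L) N (v w : 'I_N -> L) (h : {mpoly K[N]}) :
  f =1 g -> v =1 w -> mmap f v h = mmap g w h.
Proof. by move=> fg vw; apply: eq_bigr => m _; rewrite fg (mmap1_eq _ vw). Qed.

Section GenericSigns.
Variables (R : realType) (n d : nat) (p : 'M[R]_(n, d.+2)).
Hypothesis genp : generic_config p.

Lemma lengths_notin e r : uniq (e :: r) ->
  ~ foldl (@adjoin R) (config_field p) [seq lengths p 0 i | i <- r] (lengths p 0 e).
Proof.
have sqK i : config_field p (lengths p 0 i ^+ 2).
  exists (sqlengths (generic_matrix n d.+2) 0 i), 1.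
  by rewrite !rat_evalE rmorph1 mmap_generic_matrix sqr_lengths divr1 oner_eq0.
move=> uer; apply: kummer => // [|x /mapP[i _ ->] //|m sm].
  exact: config_field_subfield.
rewrite -map_mask big_map -(big_cons _ _ e _ xpredT).
apply: lengths_prod_notin => //; move: uer; rewrite /= => /andP[er ur].
by rewrite mask_uniq // andbT; apply: contra er; apply: mem_mask.
Qed.

Lemma lengths_neq0 e : lengths p 0 e != 0.
Proof.
apply/negP => /eqP e0; apply: (@lengths_notin e [::]) => //=.
by rewrite e0; apply: subfield0; apply: config_field_subfield.
Qed.

(** Induction on the number of minus signs. Each flip is a conjugation over the field generated over
    Q(p) by all the other lengths, which by [lengths_notin] misses the length being flipped. *)
Lemma signed_root (h : {mpoly rat['C(n, 2)]}) : mmap ratr (lengths p 0) h = 0 ->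
  forall f : {ffun 'I_'C(n, 2) -> bool},
    mmap ratr (fun i => (-1) ^+ f i * lengths p 0 i) h = 0.
Proof.
move=> h0 f; have [k] := ubnP #|[set i | f i]|; elim: k f => [|k IHk] f //.
have [e fe fk|f0 _] := pickP f; last first.
  by rewrite -[RHS]h0; apply: eq_mmap => // i; rewrite f0 mul1r.
pose f' := [ffun i => (i != e) && f i].
have f'f i : i != e -> f' i = f i by rewrite ffunE => ->.
have f'e : f' e = false by rewrite ffunE eqxx.
have h0' : mmap ratr (fun i => (-1) ^+ f' i * lengths p 0 i) h = 0.
  apply: IHk; rewrite -ltnS; apply: leq_trans fk; rewrite ltnS; apply: proper_card.
  apply/properP; split; first by apply/subsetP => i; rewrite !inE ffunE => /andP[].
  by exists e; rewrite inE ?f'e // fe.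
pose r := filter (predC1 e) (enum 'I_'C(n, 2)).
have uer : uniq (e :: r) by rewrite /= mem_filter /= eqxx filter_uniq ?enum_uniq.
have sqK i : config_field p (lengths p 0 i ^+ 2).
  exists (sqlengths (generic_matrix n d.+2) 0 i), 1.
  by rewrite !rat_evalE rmorph1 mmap_generic_matrix sqr_lengths divr1 oner_eq0.
have [|KK subK memK] := @foldl_adjoin_sub _ [seq lengths p 0 i | i <- r] _
    (config_field_subfield p).
  by move=> _ /mapP[i _ ->].
set K := foldl _ _ _ in KK subK memK.
have := flip_root (K := K) (e := e) KK _ _ _ h0'; rewrite f'e mul1r => flip.
rewrite -[RHS]flip //.
- apply: eq_mmap => // i; case: eqP => [->|/eqP ie]; last by rewrite f'f.
  by rewrite f'e fe mul1r mulN1r.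
- move=> i ie; rewrite -signr_odd; case: odd; rewrite ?mul1r ?mulN1r.
    apply: (subfieldN KK); apply: memK; apply: map_f.
    by rewrite mem_filter /= ie mem_enum.
  by apply: memK; apply: map_f; rewrite mem_filter /= ie mem_enum.
- exact: subK.
- exact: lengths_notin.
Qed.

(** Evaluated at squared lengths, the parity part is a polynomial in the coordinates. It vanishes at
    p, hence identically by genericity. *)
Lemma parity_part_generic_config (h : {mpoly rat['C(n, 2)]}) S (q : 'M[R]_(n, d.+2)) :
  mmap ratr (lengths p 0) h = 0 -> mmap ratr (sqlengths q 0) (parity_part S h) = 0.
Proof.
move=> /signed_root /parity_part_eq0 /(_ lengths_neq0 S) h0.
pose G := generic_matrix n d.+2.
pose g := mmap (@mpolyC _ _) (sqlengths G 0) (parity_part S h).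
have gE (q' : 'M[R]_(n, d.+2)) :
    mmap ratr (mxvec q' 0) g = mmap ratr (sqlengths q' 0) (parity_part S h).
  rewrite rmorph_mmap; apply: eq_mmap => x /=; first by rewrite mmapC.
  by rewrite mmap_generic_matrix.
have g0 : g = 0.
  apply/eqP/negPn/negP => /genp; rewrite rat_evalE gE.
  rewrite (_ : mmap _ _ _ = 0) ?eqxx // -[RHS]h0.
  by apply: eq_mmap => // i; rewrite sqr_lengths.
by rewrite -gE g0 rmorph0.
Qed.

End GenericSigns.

Lemma L_variety_signed (R : realType) n d (q : 'M[R]_(n, d)) (s : 'I_'C(n, 2) -> bool) :
  L_variety d (\row_i (real_complex R ((-1) ^+ s i * lengths q 0 i))).
Proof.
exists (map_mx (real_complex R) q); rewrite -map_sqlengths.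
apply/rowP => i; rewrite [LHS]mxE [X in X ^+ 2]mxE [RHS]mxE -rmorphXn /=.
by rewrite exprMn sqrr_sign mul1r sqr_lengths.
Qed.

(** Every sign change of the lengths of [q] lies on L, so genericity spreads the relation to all of
    them at once. Positive squared lengths keep the monomials in front of the parity parts from
    vanishing. *)
Lemma parity_part_generic_in_L (R : realType) n d (l : 'rV[R[i]]_'C(n, 2))
    (h : {mpoly rat['C(n, 2)]}) S (q : 'M[R]_(n, d)) :
  generic_in_L d l -> rat_eval h l = 0 -> (forall e, 0 < sqlengths q 0 e) ->
  mmap ratr (sqlengths q 0) (parity_part S h) = 0.
Proof.
move=> [_ genl] /genl h0 q0.
have lq0 i : lengths q 0 i != 0 by rewrite -sqrf_eq0 sqr_lengths gt_eqF.
have hs (f : {ffun 'I_'C(n, 2) -> bool}) :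
    mmap ratr (fun i => (-1) ^+ f i * lengths q 0 i) h = 0.
  have := h0 _ (L_variety_signed q f); rewrite rat_evalE => /(congr1 (@complex.Re _)) /= <-.
  rewrite (_ : mmap ratr _ h = (mmap ratr (fun i => (-1) ^+ f i * lengths q 0 i) h)%:C) //.
  rewrite rmorph_mmap; apply: eq_mmap => [x|i]; first by rewrite /= fmorph_rat.
  by rewrite mxE.
rewrite -[RHS](parity_part_eq0 hs lq0 S); apply: eq_mmap => // i.
by rewrite sqr_lengths.
Qed.

(** * Triangles of edge weights *)

Lemma ex_fresh n (s : seq 'I_n) : (size s < n)%N -> exists u, u \notin s.
Proof.
move=> sn; suff /subsetPn[u _ us] : ~~ ([set: 'I_n] \subset s) by exists u.
apply/negP => /subset_leq_card; rewrite cardsT card_ord => /leq_trans /(_ (card_size s)).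
by rewrite leqNgt sn.
Qed.

Ltac solve_uniq := rewrite /= ?inE ?negb_or ?andbT; repeat (apply/andP; split);
  by [|rewrite eq_sym].

Section Triple.
Variables (F : realFieldType) (n : nat).
Hypothesis n4 : (4 <= n)%N.
Implicit Types (A B C : 'I_n -> 'I_n -> F) (u v x y : 'I_n).

Definition deg A v := \sum_u A v u.

(* [X - Y] has cut function zero at v, vx, vxy and at the complement of u. *)
Definition flag_balanced (X Y : 'I_n -> 'I_n -> F) v x y u :=
  [/\ deg X v = deg Y v, deg X x - 2 * X v x = deg Y x - 2 * Y v x,
      deg X y - 2 * (X v y + X x y) = deg Y y - 2 * (Y v y + Y x y) &
      deg X u = deg Y u].

Definition plus A B x y := A x y + B x y.

Definition balanced_triple A B C := forall v x y u, uniq [:: v; x; y; u] ->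
  [\/ flag_balanced A (plus B C) v x y u, flag_balanced B (plus A C) v x y u |
      flag_balanced C (plus A B) v x y u].

Definition weights A :=
  [/\ forall x y, A x y = A y x, forall x, A x x = 0, forall x y, 0 <= A x y &
      exists x y, A x y != 0].

Definition differ A B := exists x y, A x y != B x y.

(** What is retained of the three rows of E on a triangle 0jk: the degenerate triangle relation on
    the cuts of each flag, nonnegativity, and from linear independence that no row is zero or the
    sum of the other two. *)
Record triple A B C : Prop := Triple {
  triple_balanced : balanced_triple A B C;
  triple_w1 : weights A; triple_w2 : weights B; triple_w3 : weights C;
  triple_d1 : differ A (plus B C); triple_d2 : differ B (plus A C);
  triple_d3 : differ C (plus A B) }.

Lemma plusC A B : plus A B = plus B A.
Proof. by apply: boolp.funext => x; apply: boolp.funext => y; rewrite /plus addrC. Qed.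

Lemma deg_plus A B v : deg (plus A B) v = deg A v + deg B v.
Proof. exact: big_split. Qed.

Lemma triple_swap12 A B C : triple A B C -> triple B A C.
Proof.
case=> bal *; split=> //; last by rewrite plusC.
by move=> v x y u /bal[] H; [apply: Or32|apply: Or31|apply: Or33; rewrite plusC].
Qed.

Lemma triple_swap23 A B C : triple A B C -> triple A C B.
Proof.
case=> bal *; split=> //; rewrite 1?(plusC C B) //.
by move=> v x y u /bal[] H; [apply: Or31; rewrite plusC|apply: Or33|apply: Or32].
Qed.

Section Weights.
Variables (A : 'I_n -> 'I_n -> F) (wA : weights A).

Lemma deg_ge0 v : 0 <= deg A v.
Proof. by case: wA => _ _ A0 _; apply: sumr_ge0. Qed.

Lemma weight_le_deg v u : A v u <= deg A v.
Proof.
by case: wA => _ _ A0 _; rewrite /deg (bigD1 u) //= lerDl sumr_ge0.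
Qed.

Lemma weight_deg0 v u : deg A v = 0 -> A v u = 0.
Proof.
move=> d0; apply/eqP; rewrite eq_le -{1}d0 weight_le_deg.
by case: wA => _ _ ->.
Qed.

Lemma weight_pos : exists x y, [/\ x != y, 0 < deg A x & 0 < deg A y].
Proof.
case: (wA) => sA dA A0 [x [y Axy]]; exists x, y; split.
- by apply: contraNneq Axy => ->; rewrite dA.
- by apply: lt_le_trans (weight_le_deg x y); rewrite lt_def Axy A0.
- by apply: lt_le_trans (weight_le_deg y x); rewrite lt_def sA Axy -sA A0.
Qed.

End Weights.

(** If the cut at v excludes the other two alternatives, every flag starting at v balances A against
    B + C. The last vertices give all degrees away from v, the second ones the weights at v, the
    third ones all remaining weights; so A = B + C, which is excluded. *)
Lemma only_first A B C v : triple A B C ->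
  deg B v <> deg A v + deg C v -> deg C v <> deg A v + deg B v -> False.
Proof.
move=> T nB nC; have [bal [sA dA _ _] [sB dB _ _] [sC dC _ _] [x0 [y0 /eqP dxy]] _ _] := T.
have balA x y u : uniq [:: v; x; y; u] -> flag_balanced A (plus B C) v x y u.
  by case/bal=> // [[+ _ _ _]|[+ _ _ _]]; rewrite deg_plus => /esym/esym.
have degE u : u != v -> deg A u = deg B u + deg C u.
  move=> uv; have [x] := @ex_fresh n [:: v; u] (ltnW n4); rewrite !inE negb_or => /andP[xv xu].
  have [y] := @ex_fresh n [:: v; u; x] n4; rewrite !inE !negb_or => /and3P[yv yu yx].
  have [|_ _ _] := balA x y u; last by rewrite deg_plus.
  solve_uniq.
have Av x : x != v -> A v x = B v x + C v x.
  move=> xv; have [y] := @ex_fresh n [:: v; x] (ltnW n4); rewrite !inE negb_or => /andP[yv yx].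
  have [u] := @ex_fresh n [:: v; x; y] n4; rewrite !inE !negb_or => /and3P[uv ux uy].
  have [|_ + _ _] := balA x y u.
    solve_uniq.
  rewrite deg_plus degE // /plus; lra.
case: dxy; rewrite /plus.
have [->|xy] := eqVneq x0 y0; first by rewrite dA dB dC addr0.
have [xv|xv] := eqVneq x0 v; first by rewrite xv Av // eq_sym -xv.
have [yv|yv] := eqVneq y0 v; first by rewrite sA sB sC yv Av.
have [u] := @ex_fresh n [:: v; x0; y0] n4; rewrite !inE !negb_or => /and3P[uv ux uy].
have [|_ _ + _] := balA x0 y0 u.
  solve_uniq.
rewrite deg_plus degE // /plus Av //; lra.
Qed.

(** By [only_first] at least two of the three additive relations hold at v, and any two force one
    degree to vanish and the other two to agree. *)
Lemma vertex_type A B C v : triple A B C ->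
  [\/ deg A v = 0 /\ deg B v = deg C v, deg B v = 0 /\ deg A v = deg C v |
      deg C v = 0 /\ deg A v = deg B v].
Proof.
move=> T; have nA := only_first (v := v) T; have nB := only_first (v := v) (triple_swap12 T).
have nC := only_first (v := v) (triple_swap12 (triple_swap23 T)).
have [A1|A1] := eqVneq (deg A v) (deg B v + deg C v);
have [B1|B1] := eqVneq (deg B v) (deg A v + deg C v);
have [C1|C1] := eqVneq (deg C v) (deg A v + deg B v);
by [apply: Or31; split; lra | apply: Or32; split; lra | apply: Or33; split; lra].
Qed.

(** Then B and C have positive degree at disjoint sets of vertices. A flag from a vertex of B to a
    vertex of C, or back, excludes the alternatives for B and C by its first and last cuts, so it
    balances A against B + C. Enough such flags exist to reach every pair, and A = B + C follows. *)
Lemma not_all_first A B C : triple A B C -> (forall v, deg A v = deg B v + deg C v) -> False.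
Proof.
move=> T degA.
have [bal [sA dA _ _] wB wC [x [y /eqP dxy]] _ _] := T; apply: dxy; rewrite /plus.
have [sB dB _ _] := wB; have [sC dC _ _] := wC.
have [b [b' [bb' b0 b0']]] := weight_pos wB; have [c [c' [cc' c0 c0']]] := weight_pos wC.
have BC v : 0 < deg B v -> deg C v = 0.
  move=> v0; have := degA v; have := deg_ge0 wC v; have [] := vertex_type v T; lra.
have first v u z t : uniq [:: v; z; t; u] -> 0 < deg B v -> 0 < deg C u ->
   A v z = B v z + C v z /\ A z t = B z t + C z t.
  move=> uq Bv Cu; have Cv := BC _ Bv; have Bu : deg B u = 0.
    by have := deg_ge0 wB u; rewrite le_eqVlt => /orP[/eqP//|/BC]; lra.
  have uq' : uniq [:: v; t; z; u].
    by move: uq; rewrite /= !inE !negb_or (eq_sym t z); do ![case: eqP => //=].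
  have H z' t' : uniq [:: v; z'; t'; u] -> A v z' = B v z' + C v z' /\
      A v t' + A z' t' = B v t' + C v t' + (B z' t' + C z' t').
    move=> /bal[] []; rewrite !deg_plus /plus ?degA => *; try (exfalso; lra).
    split; lra.
  by have [? ?] := H _ _ uq; have [? ?] := H _ _ uq'; split=> //; lra.
have Cpos u : 0 < deg C u -> deg B u = 0.
  by move=> Cu; have := deg_ge0 wB u; rewrite le_eqVlt => /orP[/eqP//|/BC]; lra.
have last v u z t : uniq [:: v; z; t; u] -> 0 < deg B v -> 0 < deg C u ->
   A u z = B u z + C u z.
  move=> uq Bv Cu; have Cv := BC _ Bv; have Bu := Cpos _ Cu.
  have /bal[] : uniq [:: u; z; t; v].
  - by move: uq; rewrite /= !inE !negb_or !(eq_sym u) (eq_sym v t) (eq_sym v z); do ![case: eqP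
      => //=].
  - by case; rewrite !deg_plus /plus ?degA; lra.
  - by case; rewrite !deg_plus /plus ?degA; lra.
  - by case; rewrite !deg_plus /plus ?degA; lra.
have [->|xy] := eqVneq x y; first by rewrite dA dB dC addr0.
have exB z : exists2 w, w != z & 0 < deg B w.
  by have [bz|bz] := eqVneq b z; [exists b' => //; rewrite -bz eq_sym | exists b].
have exC z : exists2 w, w != z & 0 < deg C w.
  by have [cz|cz] := eqVneq c z; [exists c' => //; rewrite -cz eq_sym | exists c].
have BneqC v u : 0 < deg B v -> 0 < deg C u -> v != u.
  by move=> /BC Cv; apply: contraTneq => <-; rewrite Cv ltxx.
have fresh3 (z t w : 'I_n) : exists k, [/\ k != z, k != t & k != w].
  by have [k] := @ex_fresh n [:: z; t; w] n4; rewrite !inE !negb_or => /and3P[]; exists k.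
have fromB z t : z != t -> 0 < deg B z -> A z t = B z t + C z t.
  move=> zt Bz; have [u ut Cu] := exC t; have zu := BneqC _ _ Bz Cu.
  have [k [kz kt ku]] := fresh3 z t u.
  by have [|? _] := first z u t k _ Bz Cu; first solve_uniq.
have fromC z t : z != t -> 0 < deg C z -> A z t = B z t + C z t.
  move=> zt Cz; have [v vt Bv] := exB t; have vz := BneqC _ _ Bv Cz.
  have [k [kz kt kv]] := fresh3 z t v.
  by apply: (last v z t k) => //; solve_uniq.
have yx : y != x by rewrite eq_sym.
case: (ltP 0 (deg B x)) => [Bx|Bx]; first exact: fromB.
case: (ltP 0 (deg C x)) => [Cx|Cx]; first exact: fromC.
case: (ltP 0 (deg B y)) => [By|By]; first by rewrite sA sB sC fromB.
case: (ltP 0 (deg C y)) => [Cy|Cy]; first by rewrite sA sB sC fromC.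
have neqB z w : deg B z <= 0 -> 0 < deg B w -> z != w.
  by move=> z0; apply: contraTneq => <-; rewrite -leNgt.
have neqC z w : deg C z <= 0 -> 0 < deg C w -> z != w.
  by move=> z0; apply: contraTneq => <-; rewrite -leNgt.
have [|_ //] := first b c x y _ b0 c0.
have := neqB _ _ Bx b0; have := neqB _ _ By b0; have := neqC _ _ Cx c0; have := neqC _ _ Cy c0.
by have := BneqC _ _ b0 c0 => *; solve_uniq.
Qed.

(** On a flag starting with v, c and ending with u, the zero degrees at v and u leave only the
    alternative C = A + B. On the cut vc it reads deg A c + deg B c = 2 B v c, and the two degrees
    at c agree. *)
Lemma full_weight A B C v u c : triple A B C ->
  deg A v = 0 -> 0 < deg B v -> deg B u = 0 -> 0 < deg A u -> deg C c = 0 ->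
  0 < deg A c -> B c v = deg B c.
Proof.
move=> T Av Bv Bu Au Cc Ac; have [bal wA [sB _ B0 _] wC _ _ _] := T.
have [sA _ _ _] := wA; have [sC _ _ _] := wC.
have Bc : deg B c = deg A c by have [] := vertex_type c T; lra.
have uv : u != v by apply: contraTneq Au => ->; rewrite Av ltxx.
have cv : c != v by apply: contraTneq Ac => ->; rewrite Av ltxx.
have cu : c != u by apply: contraTneq Ac => cu; rewrite -Bc cu Bu ltxx.
have [y] := @ex_fresh n [:: v; u; c] n4; rewrite !inE !negb_or => /and3P[yv yu yc].
have /bal[] : uniq [:: v; c; y; u] by solve_uniq.
- by case; rewrite !deg_plus; have := deg_ge0 wC v; lra.
- by case; rewrite !deg_plus; have := deg_ge0 wC u; lra.
case=> _ + _ _; rewrite deg_plus /plus (weight_deg0 wA c Av) (sC v) (weight_deg0 wC v Cc) sB.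
lra.
Qed.

(** Two such vertices would each carry the whole positive degree of B at c. *)
Lemma unique_vertex A B C a v u c : triple A B C ->
  deg A a = 0 -> 0 < deg B a -> deg A v = 0 -> 0 < deg B v ->
  deg B u = 0 -> 0 < deg A u -> deg C c = 0 -> 0 < deg A c -> v = a.
Proof.
move=> T Aa Ba Av Bv Bu Au Cc Ac; apply/eqP/negPn/negP => va.
have Bca := full_weight T Aa Ba Bu Au Cc Ac; have Bcv := full_weight T Av Bv Bu Au Cc Ac.
have [_ _ [_ _ B0 _] _ _ _ _] := T.
have Bc : deg B c = deg A c by have [] := vertex_type c T; lra.
have : B c v + B c a <= deg B c.
  by rewrite /deg (bigD1 a) // addrC lerD2l (bigD1 v) //= lerDl sumr_ge0.
lra.
Qed.

Definition indicator (s : F) b c x y : F :=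
  if (x == b) && (y == c) || (x == c) && (y == b) then s else 0.

Lemma weight_indicator A b c : weights A ->
  (forall x, 0 < deg A x -> x = b \/ x = c) -> A =2 indicator (A b c) b c.
Proof.
move=> wA bc x y; have [sA dA A0 _] := wA; rewrite /indicator; case: ifP.
  by case/orP => /andP[/eqP-> /eqP->].
move=> nxy; apply/eqP/negPn/negP => Axy.
have Ax : 0 < deg A x by apply: lt_le_trans (weight_le_deg wA x y); rewrite lt_def Axy A0.
have Ay : 0 < deg A y by apply: lt_le_trans (weight_le_deg wA y x); rewrite lt_def sA Axy -sA A0.
by move: nxy Axy; case: (bc _ Ax) => ->; case: (bc _ Ay) => ->; rewrite !eqxx ?orbT ?dA ?eqxx.
Qed.

(** At a vertex where deg A differs from deg B + deg C, [vertex_type] leaves only the case deg A =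
    0, with deg B nonzero. *)
Lemma ex_degree0 A B C : triple A B C ->
  exists v, [/\ deg A v = 0, 0 < deg B v & deg B v = deg C v].
Proof.
move=> T; have [v nv] : exists v, deg A v <> deg B v + deg C v.
  by apply/boolp.existsNP => H; apply: (not_all_first T).
have [_ _ wB _ _ _ _] := T.
exists v; have B0 := deg_ge0 wB v; have [] := vertex_type v T => -[v1 v2]; split; try lra.
Qed.

(** Each of the three vertex types with nonzero degrees occurs at exactly one vertex, called a, b
    and c. Hence A lives on bc, B on ac and C on ab, and comparing degrees through [full_weight]
    makes the three weights equal. *)
Lemma triple_classification A B C : triple A B C ->
  exists a b c s, [/\ uniq [:: a; b; c], 0 < s, A =2 indicator s b c,
    B =2 indicator s a c & C =2 indicator s a b].
Proof.
move=> T; have TB := triple_swap12 T; have TA' := triple_swap23 T.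
have TC := triple_swap12 TA'.
have [a [Aa Ba BCa]] := ex_degree0 T; have [b [Bb Ab ACb]] := ex_degree0 TB.
have [c [Cc Ac ABc]] := ex_degree0 TC.
have Ca : 0 < deg C a by lra. have Cb : 0 < deg C b by lra. have Bc : 0 < deg B c by lra.
have isa v : deg A v = 0 -> 0 < deg B v -> v = a.
  by move=> Av Bv; apply: unique_vertex T Aa Ba Av Bv Bb Ab Cc Ac.
have isb v : deg B v = 0 -> 0 < deg A v -> v = b.
  by move=> Bv Av; apply: unique_vertex TB Bb Ab Bv Av Aa Ba Cc Bc.
have isc v : deg C v = 0 -> 0 < deg A v -> v = c.
  by move=> Cv Av; apply: unique_vertex TC Cc Ac Cv Av Aa Ca Bb Cb.
have Acb := full_weight TB Bb Ab Aa Ba Cc Bc.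
have Abc := full_weight TC Cc Ac Aa Ca Bb Cb.
have Bca := full_weight T Aa Ba Bb Ab Cc Ac.
have Cba := full_weight TA' Aa Ca Cc Ac Bb Ab.
have [_ wA wB wC _ _ _] := T.
have inA x : 0 < deg A x -> x = b \/ x = c.
  by move=> Ax; case: (vertex_type x T) => -[x1 x2]; [exfalso; lra | left; apply: isb | right;
      apply: isc].
have inB x : 0 < deg B x -> x = a \/ x = c.
  move=> Bx; case: (vertex_type x T) => -[x1 x2]; [left; exact: isa | exfalso; lra | right].
  by apply: isc => //; rewrite x2.
have inC x : 0 < deg C x -> x = a \/ x = b.
  move=> Cx; case: (vertex_type x T) => -[x1 x2]; [left | right | exfalso; lra].
    by apply: isa => //; rewrite x2.
  by apply: isb => //; rewrite x2.
have [[sB _ _ _] [sC _ _ _]] := conj wB wC.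
have AB : A b c = B a c by rewrite sB Bca Abc; have := Acb; have [sA _ _ _] := wA; rewrite sA;
    lra.
have AC : A b c = C a b by rewrite sC Cba Abc ACb.
exists a, b, c, (A b c); split.
- have ab : a != b by apply: contraTneq Ab => <-; rewrite Aa ltxx.
  have ac : a != c by apply: contraTneq Ac => <-; rewrite Aa ltxx.
  have bc : b != c by apply: contraTneq Bc => <-; rewrite Bb ltxx.
  solve_uniq.
- by rewrite Abc.
- exact: weight_indicator.
- by rewrite AB; apply: weight_indicator.
- by rewrite AC; apply: weight_indicator.
Qed.

End Triple.

(** * From line configurations to cuts along flags *)

Section Flags.
Variables (F : realFieldType) (n : nat).
Implicit Types (X : 'rV[F]_'C(n, 2)) (xi : 'I_n -> F).

Definition line_length X xi :=
  \sum_e X 0 e * `|xi (pair_of e).1 - xi (pair_of e).2|.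

Definition cut_weight X (U : pred 'I_n) :=
  \sum_e X 0 e * (U (pair_of e).1 != U (pair_of e).2)%:R.

Lemma cut_weight_sum X U :
  cut_weight X U = \sum_(a | U a) \sum_(b | ~~ U b) edge_at X a b.
Proof.
under eq_bigr => a _ do under eq_bigr => b _ do rewrite /edge_at big_mkcond.
rewrite pair_big exchange_big; apply: eq_bigr => e _ /=.
rewrite -big_mkcondr /=; case ee: (pair_of e) => [i j].
have ij : i != j by have := pair_of_neq e; rewrite ee.
have [Ui|nUi] := boolP (U i); have [Uj|nUj] := boolP (U j); rewrite /= ?mulr0 ?mulr1.
- rewrite big_pred0 // => -[a b] /=; apply/negP => /andP[/andP[Ua Ub]].
  by rewrite /joins ee => /orP[] /eqP[ia jb]; move: Ub; rewrite -?ia -?jb ?Ui ?Uj.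
- rewrite (big_pred1 (i, j)) // => -[a b] /=; rewrite /joins ee.
  apply/andP/eqP => [[/andP[Ua Ub] /orP[]/eqP[ia jb]] | [-> ->]]; last by rewrite Ui nUj eqxx.
    by rewrite ia jb.
  by move: Ub; rewrite -ia Ui.
- rewrite (big_pred1 (j, i)) // => -[a b] /=; rewrite /joins ee.
  apply/andP/eqP => [[/andP[Ua Ub] /orP[]/eqP[ia jb]] | [-> ->]]; last by rewrite Uj nUi eqxx
      orbT.
    by move: Ub; rewrite -jb Uj.
  by rewrite ia jb.
rewrite big_pred0 // => -[a b] /=; apply/negP => /andP[/andP[Ua Ub]].
by rewrite /joins ee => /orP[] /eqP[ia jb]; move: Ua; rewrite -?ia -?jb ?(negPf nUi) ?(negPf nUj).
Qed.

(** Complementary sets have the same cut, so the last cut of a flag is read off from the one vertex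
    it leaves out. *)
Lemma cut_weight_seq X U (s : seq 'I_n) : uniq s -> U =1 (fun z => z \in s) \/ U =1 (fun z => z
    \notin s) ->
  cut_weight X U = \sum_(a <- s) (deg (edge_at X) a - \sum_(b <- s) edge_at X a b).
Proof.
move=> us Us; have -> : cut_weight X U = cut_weight X (fun z => z \in s).
  apply: eq_bigr => e _; case: Us => Us; rewrite !Us //.
  by case: (_ \in s); case: (_ \in s).
rewrite cut_weight_sum big_uniq //=; apply: eq_bigr => a _.
rewrite /deg [X in X - _](bigID (fun z => z \in s)) /= [\sum_(b <- s) _]big_uniq //=.
by rewrite addrAC subrr add0r.
Qed.

(* For 0 < t this orders the points along the line by rank. *)
Definition staircase (rho : 'I_n -> nat) K (t : F) z := \sum_(k < K | (rho z <= k)%N) t ^+ k.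

Definition cut_poly X (rho : 'I_n -> nat) K : {poly F} :=
  \poly_(k < K) cut_weight X (fun z => (rho z <= k)%N).

Lemma staircaseB rho K t a b : (rho a <= rho b)%N ->
  staircase rho K t a - staircase rho K t b =
    \sum_(k < K) ((rho a <= k) != (rho b <= k))%N%:R * t ^+ k.
Proof.
move=> ab; rewrite /staircase big_mkcond [X in _ - X]big_mkcond -sumrB.
apply: eq_bigr => k _; case: (leqP (rho b) k) => [bk|_].
  by rewrite (leq_trans ab bk) subrr mul0r.
by case: leqP; rewrite ?mul1r ?mul0r subr0.
Qed.

Lemma norm_staircaseB rho K t a b : 0 <= t ->
  `|staircase rho K t a - staircase rho K t b| =
    \sum_(k < K) ((rho a <= k) != (rho b <= k))%N%:R * t ^+ k.
Proof.
move=> t0; wlog ab : a b / (rho a <= rho b)%N.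
  move=> H; case/orP: (leq_total (rho a) (rho b)) => /H //; rewrite distrC => ->.
  by apply: eq_bigr => k _; rewrite eq_sym.
rewrite staircaseB // ger0_norm // sumr_ge0 // => k _.
by rewrite mulr_ge0 ?ler0n ?exprn_ge0.
Qed.

Lemma staircase_inj rho K t : injective rho -> (forall z, rho z < K)%N -> 0 < t ->
  injective (staircase rho K t).
Proof.
move=> rho_inj rhoK t0 a b; wlog ab : a b / (rho a <= rho b)%N.
  by move=> H ab; case/orP: (leq_total (rho a) (rho b)) => ?; [|apply/esym]; apply: H.
move=> /eqP; rewrite -subr_eq0 staircaseB // psumr_eq0 => [/allP/(_ (Ordinal (rhoK a)))|k _].
  rewrite mem_index_enum leqnn /= => /(_ isT); case: leqP => [ba _|_].
    by apply: rho_inj; apply/eqP; rewrite eqn_leq ab.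
  by rewrite mul1r expf_eq0 gt_eqF // andbF.
by rewrite mulr_ge0 ?ler0n ?exprn_ge0 // ltW.
Qed.

(** The distance between two points of a staircase is the sum of t^k over the cuts k that separate
    them. *)
Lemma horner_cut_poly X rho K t : 0 <= t ->
  (cut_poly X rho K).[t] = line_length X (staircase rho K t).
Proof.
move=> t0; rewrite horner_poly /line_length /cut_weight.
under eq_bigr => k _ do rewrite mulr_suml.
rewrite exchange_big; apply: eq_bigr => e _ /=.
rewrite norm_staircaseB // mulr_sumr; apply: eq_bigr => k _.
by rewrite mulrA.
Qed.

Definition collinear_triple (A B C : 'rV[F]_'C(n, 2)) := forall xi, injective xi ->
  [\/ line_length A xi = line_length B xi + line_length C xi,
      line_length B xi = line_length A xi + line_length C xi |
      line_length C xi = line_length A xi + line_length B xi].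

(** For every t > 0 one of the three relations holds, so the product of three difference polynomials
    vanishes and one factor is zero. This makes the same alternative hold on all cuts of the
    flag. *)
Lemma cut_weights_triple A B C rho K : collinear_triple A B C ->
  injective rho -> (forall z, rho z < K)%N ->
  let cw X k := cut_weight X (fun z => (rho z <= k)%N) in
  [\/ forall k, (k < K)%N -> cw A k = cw B k + cw C k,
      forall k, (k < K)%N -> cw B k = cw A k + cw C k |
      forall k, (k < K)%N -> cw C k = cw A k + cw B k].
Proof.
move=> col rho_inj rhoK cw; pose P X := cut_poly X rho K.
have coefP X Y Z : P X - P Y - P Z = 0 -> forall k, (k < K)%N -> cw X k = cw Y k + cw Z k.
  move=> P0 k kK; have := congr1 (fun p : {poly F} => p`_k) P0.
  by rewrite !coefB !coef_poly kK coef0 -/(cw X k) -/(cw Y k) -/(cw Z k); lra.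
have : 'X * ((P A - P B - P C) * (P B - P A - P C) * (P C - P A - P B)) = 0.
  apply: poly_nneg_eq0 => t; rewrite le_eqVlt => /orP[/eqP<-|t0]; first by rewrite hornerM
      hornerX mul0r.
  rewrite !hornerM !hornerD !hornerN /P !horner_cut_poly ?ltW //.
  by case: (col _ (staircase_inj rho_inj rhoK t0)) => ->; ring.
move=> /eqP; rewrite !mulf_eq0 polyX_eq0 /= -orbA => /or3P[] /eqP /coefP ?.
- exact: Or31.
- exact: Or32.
- exact: Or33.
Qed.

Lemma triple_of_collinear A B C : (4 <= n)%N -> collinear_triple A B C ->
  (forall e, 0 <= A 0 e) -> (forall e, 0 <= B 0 e) -> (forall e, 0 <= C 0 e) ->
  A != 0 -> B != 0 -> C != 0 -> A != B + C -> B != A + C -> C != A + B ->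
  triple (edge_at A) (edge_at B) (edge_at C).
Proof.
move=> n4 col A0 B0 C0 Az Bz Cz AB BA CA.
have weightsP X : (forall e, 0 <= X 0 e) -> X != 0 -> weights (edge_at X).
  move=> X0 /rV0Pn[e Xe]; split; [exact: edge_at_sym|exact: edge_at_diag| |].
    by move=> x y; apply: sumr_ge0.
  by exists (pair_of e).1, (pair_of e).2; rewrite edge_at_pair_of.
have differP X Y Z : X != Y + Z -> differ (edge_at X) (plus (edge_at Y) (edge_at Z)).
  rewrite -subr_eq0 => /rV0Pn[e]; rewrite !mxE subr_eq0 => XYZ.
  by exists (pair_of e).1, (pair_of e).2; rewrite /plus !edge_at_pair_of.
split; try exact: weightsP; try exact: differP.
move=> v x y u uq.
(* The order puts v, x, y first and u last, with all other points strictly between at z + 3 < n + 3.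
   The cuts at 0, 1, 2 and n + 2 are then v, vx, vxy and the complement of u. *)
pose rho (z : 'I_n) := if z == v then 0%N else if z == x then 1%N else if z == y then 2%N
  else if z == u then n.+3 else z.+3.
have rho_inj : injective rho.
  move=> z z'; rewrite /rho; have zn := ltn_ord z; have zn' := ltn_ord z'.
  case: (z =P v) => [->|_]; [|case: (z =P x) => [->|_]; [|case: (z =P y) => [->|_];
    [|case: (z =P u) => [->|_]]]];
  (case: (z' =P v) => [->|_]; [|case: (z' =P x) => [->|_]; [|case: (z' =P y) => [->|_];
    [|case: (z' =P u) => [->|_]]]]) => //.
  - by case=> E; rewrite -E ltnn in zn'.
  - by case=> E; rewrite E ltnn in zn.
  by case; apply: ord_inj.
have rhoK z : (rho z < n.+4)%N.
  rewrite /rho; do ![case: eqP => // _]; by rewrite !ltnS ltnW.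
have cwE := cut_weights_triple col rho_inj rhoK; move: cwE => /=.
have bal X Y Z : (forall k, (k < n.+4)%N -> cut_weight X (fun z => (rho z <= k)%N) =
    cut_weight Y (fun z => (rho z <= k)%N) + cut_weight Z (fun z => (rho z <= k)%N)) ->
    flag_balanced (edge_at X) (plus (edge_at Y) (edge_at Z)) v x y u.
  move=> cw.
  have c0 W : cut_weight W (fun z => (rho z <= 0)%N) = deg (edge_at W) v.
    rewrite (@cut_weight_seq _ _ [:: v]) ?big_seq1 ?edge_at_diag ?subr0 //.
    left=> z; rewrite inE /rho; do ![case: eqP => //].
  have c1 W : cut_weight W (fun z => (rho z <= 1)%N) = deg (edge_at W) v + (deg (edge_at W) x -
      2 * edge_at W v x).
    rewrite (@cut_weight_seq _ _ [:: v; x]); first by rewrite !big_cons !big_nil !edge_at_diag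
        (edge_at_sym _ x v); lra.
      by move: uq; rewrite /= !inE !negb_or; case/andP => /and3P[-> _ _] _.
    by left=> z; rewrite !inE /rho; do ![case: eqP => //].
  have c2 W : cut_weight W (fun z => (rho z <= 2)%N) = deg (edge_at W) v + deg (edge_at W) x -
      2 * edge_at W v x
     + (deg (edge_at W) y - 2 * (edge_at W v y + edge_at W x y)).
    rewrite (@cut_weight_seq _ _ [:: v; x; y]).
    - by rewrite !big_cons !big_nil !edge_at_diag (edge_at_sym _ x v) (edge_at_sym _ y v)
        (edge_at_sym _ y x); lra.
    - by move: uq; rewrite -[[:: v; x; y; u]]/([:: v; x; y] ++ [:: u]) cat_uniq => /andP[].
    by left=> z; rewrite !inE /rho; do ![case: eqP => //].
  have c3 W : cut_weight W (fun z => (rho z <= n.+2)%N) = deg (edge_at W) u.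
    rewrite (@cut_weight_seq _ _ [:: u]) ?big_seq1 ?edge_at_diag ?subr0 //.
    right=> z; rewrite inE /rho; move: uq; rewrite /= !inE !negb_or => uq.
    have zn := ltn_ord z; case: (eqVneq z u) => [->|_].
      by case/and4P: uq => /and3P[_ _ /negPf vu] /andP[_ /negPf xu] /negPf yu _; rewrite
          !(eq_sym u) vu xu yu ltnn.
    by do ![case: eqP => // _]; rewrite !ltnS.
  have := cw 0%N isT; have := cw 1%N isT; have := cw 2%N isT; have := cw n.+2 (leqnSn _).
  rewrite !c0 !c1 !c2 !c3 /flag_balanced !deg_plus /plus => *; split; lra.
by case=> /bal ?; [exact: Or31 | exact: Or32 | exact: Or33].
Qed.

End Flags.

(** * The relabelling *)

Section Relabelling.
Variables (F : realFieldType) (m n : nat).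

Lemma indicator_inj (s s' : F) (b c b' c' : 'I_n) : b != c -> 0 < s ->
  indicator s b c =2 indicator s' b' c' ->
  s = s' /\ ((b' = b /\ c' = c) \/ (b' = c /\ c' = b)).
Proof.
move=> bc s0 /(_ b c); rewrite /indicator !eqxx /=; case: ifP => [|_ s0']; last first.
  by move: s0; rewrite s0' ltxx.
by move=> /orP[] /andP[/eqP-> /eqP->] ->; split=> //; [left|right].
Qed.

Lemma indicatorC (s : F) (b c : 'I_n) : indicator s b c =2 indicator s c b.
Proof. by move=> x y; rewrite /indicator orbC. Qed.

Variable W : 'I_m.+1 -> 'I_m.+1 -> 'I_n -> 'I_n -> F.
Hypothesis m3 : (3 <= m)%N.
Hypothesis WC : forall u v, W u v =2 W v u.
Hypothesis W_triple : forall j k, uniq [:: ord0; j; k] ->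
  exists a b c s, [/\ uniq [:: a; b; c], 0 < s, W j k =2 indicator s b c,
    W ord0 k =2 indicator s a c & W ord0 j =2 indicator s a b].
Hypothesis W_inj : forall u v u' v', u != v -> u' != v' ->
  W u v =2 W u' v' -> (u', v') = (u, v) \/ (u', v') = (v, u).

(** The edges W 0 j pairwise share a vertex. If one of them missed the common vertex v of the first
    two, it would close a triangle with them and coincide with W j1 j2, against injectivity. *)
Lemma star_center : exists v s, 0 < s /\ forall j, j != ord0 ->
  exists2 t, t != v & W ord0 j =2 indicator s v t.
Proof.
have [j1] := @ex_fresh _ [:: ord0 : 'I_m.+1] (ltnW (ltnW m3)); rewrite inE => j10.
have [j2] := @ex_fresh _ [:: ord0; j1] (ltnW m3); rewrite !inE negb_or => /andP[j20 j21].
have [|v [t1 [t2 [s [uvt s0 W12 W02 W01]]]]] := @W_triple j1 j2; first solve_uniq.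
have [vt1 vt2 t12] : [/\ v != t1, v != t2 & t1 != t2].
  by move: uvt; rewrite /= !inE negb_or andbT => /andP[/andP[]].
exists v, s; split=> // j j0.
have [->|jj1] := eqVneq j j1; first by exists t1; rewrite // eq_sym.
have [->|jj2] := eqVneq j j2; first by exists t2; rewrite // eq_sym.
have [|a [b [c [s' [uabc s0' W1j W0j W01']]]]] := @W_triple j1 j; first solve_uniq.
have [ab ac bc] : [/\ a != b, a != c & b != c].
  by move: uabc; rewrite /= !inE negb_or andbT => /andP[/andP[]].
have [|ss' [[av bt]|[at1 bv]]] := @indicator_inj s s' v t1 a b vt1 s0.
- by move=> x y; rewrite -W01 W01'.
- by exists c; rewrite -?av 1?eq_sym // ss'.
have [|a' [b' [c' [s'' [uabc' s0'' W2j W0j' W02']]]]] := @W_triple j2 j; first solve_uniq.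
have [ab' ac' bc'] : [/\ a' != b', a' != c' & b' != c'].
  by move: uabc'; rewrite /= !inE negb_or andbT => /andP[/andP[]].
have [|ss'' [[av' bt']|[at2 bv']]] := @indicator_inj s s'' v t2 a' b' vt2 s0.
- by move=> x y; rewrite -W02 W02'.
- have [|_ [[]|[]]] := @indicator_inj s' s'' a c a' c' ac s0'.
  + by move=> x y; rewrite -W0j W0j'.
  + by rewrite av' at1 => vE; rewrite vE eqxx in vt1.
  by rewrite av' => vc; rewrite bv vc eqxx in bc.
have [|_ [[]|[]]] := @indicator_inj s' s'' a c a' c' ac s0'.
- by move=> x y; rewrite -W0j W0j'.
- by rewrite at2 at1 => tE; rewrite tE eqxx in t12.
rewrite at2 => tc _; exfalso.
have ne : j1 != j2 by rewrite eq_sym.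
have ne' : ord0 != j by rewrite eq_sym.
have E : W j1 j2 =2 W ord0 j by move=> x y; rewrite W12 W0j tc at1 ss'.
by case: (W_inj ne ne' E) => -[E1 _]; [rewrite -E1 eqxx in j10 | rewrite -E1 eqxx in j20].
Qed.

(** The centre of the star is the image of 0 and the far end of W 0 j is the image of j. For j and k
    nonzero, W j k is the third side of a triangle and joins the two far ends. *)
Lemma relabelling : exists T s, [/\ injective T, 0 < s &
  forall u v, u != v -> W u v =2 indicator s (T u) (T v)].
Proof.
have [v [s [s0 star]]] := star_center.
have [T0 T0P] : exists T0, forall j, j != ord0 -> T0 j != v /\ W ord0 j =2 indicator s v (T0 j).
  have /choice[T0 T0P] j : exists t, j != ord0 -> t != v /\ W ord0 j =2 indicator s v t.
    have [->|/star[t tv Wt]] := eqVneq j ord0; [by exists v; rewrite eqxx | by exists t].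
  by exists T0.
have T0_inj j k : j != ord0 -> k != ord0 -> T0 j = T0 k -> j = k.
  move=> j0 k0 jk; have [_ Wj] := T0P _ j0; have [_ Wk] := T0P _ k0.
  have j0' : ord0 != j by rewrite eq_sym.
  have k0' : ord0 != k by rewrite eq_sym.
  have E : W ord0 j =2 W ord0 k by move=> x y; rewrite Wj Wk jk.
  by case: (W_inj j0' k0' E) => -[]; [| move=> E1 _; rewrite -E1 eqxx in j0].
pose T j := if j == ord0 then v else T0 j.
exists T, s; split=> // [j k|j k jk]; rewrite /T.
  case: (eqVneq j ord0) => [->|j0]; case: (eqVneq k ord0) => [->|k0] //.
  - by move=> vk; have [] := T0P _ k0; rewrite -vk eqxx.
  - by move=> vj; have [] := T0P _ j0; rewrite vj eqxx.
  exact: T0_inj.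
case: (eqVneq j ord0) jk => [->|j0]; case: (eqVneq k ord0) => [->|k0] jk.
- by move: jk; rewrite ?eqxx.
- by have [] := T0P _ k0.
- by move=> x y; rewrite WC indicatorC; have [_ ->] := T0P _ j0.
have [|a [b [c [s' [uabc s0' Wjk Wk Wj]]]]] := @W_triple j k; first solve_uniq.
have [vj Wj'] := T0P _ j0; have [vk Wk'] := T0P _ k0.
have nT : T0 j != T0 k by apply: contraNneq jk => /T0_inj ->.
have [||ss' [[av bj]|[aj bv]]] := @indicator_inj s s' v (T0 j) a b _ s0; rewrite 1?eq_sym //.
- by move=> x y; rewrite -Wj' Wj.
- have [||_ [[_ ck]|[ak cv]]] := @indicator_inj s s' v (T0 k) a c _ s0; rewrite 1?eq_sym //.
  + by move=> x y; rewrite -Wk' Wk.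
  + by move=> x y; rewrite Wjk ss' bj ck.
  by move: vk; rewrite -ak av eqxx.
have [||_ [[av _]|[ak _]]] := @indicator_inj s s' v (T0 k) a c _ s0; rewrite 1?eq_sym //.
- by move=> x y; rewrite -Wk' Wk.
- by move: vj; rewrite -aj av eqxx.
by move: nT; rewrite -aj ak eqxx.
Qed.

End Relabelling.

(** * Reconstruction *)

Lemma mmap_map_mpoly (K L : comNzRingType) (f : {rmorphism rat -> K}) (g : {rmorphism K -> L})
    N (v : 'I_N -> L) (h : {mpoly rat[N]}) :
  mmap g v (map_mpoly f h) = mmap (g \o f) v h.
Proof.
rewrite /map_mpoly rmorph_mmap; apply: eq_mmap => x /=; first by rewrite mmapC.
by rewrite mmapX mmap1U.
Qed.

(** The composite f o E as a polynomial over Q, so that both forms of genericity apply to it. *)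
Definition gram_poly N m (E : 'M[rat]_('C(m.+1, 2), N)) : {mpoly rat[N]} :=
  \det (gram (sqr_mx ((\row_e 'X_e) *m (map_mx (@mpolyC _ _) E)^T))).

Lemma mmap_gram_poly (K : comNzRingType) (f : {rmorphism rat -> K}) N m
    (E : 'M[rat]_('C(m.+1, 2), N)) (x : 'rV[K]_N) :
  mmap f (x 0) (gram_poly E) = \det (gram (sqr_mx (x *m (map_mx f E)^T))).
Proof.
rewrite /gram_poly -det_map_mx map_gram; congr (\det (gram _)).
apply/rowP => i; rewrite /sqr_mx !mxE /= rmorphXn; congr (_ ^+ 2); rewrite rmorph_sum /=.
apply: eq_bigr => e _; rewrite rmorphM !mxE /= mmapC; congr (_ * _).
by rewrite mmapX mmap1U.
Qed.

Lemma rational_rank_full (F : fieldType) m (w : 'rV[F]_m) :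
  rational_rank w = m -> forall c : 'I_m -> rat, \sum_i ratr (c i) * w 0 i = 0 -> forall i, c i
      = 0.
Proof.
move=> wm c cw.
have [|A /asboolP indA AE] := @eq_bigmax_cond _ [pred A : {set 'I_m} | `[< rat_independent w A
    >]] (fun A => #|A|).
  apply/card_gt0P; exists set0; rewrite inE; apply/asboolP => c' _ i.
  by rewrite inE.
have AT : A = setT by apply/eqP; rewrite eqEcard subsetT cardsT card_ord -AE -[X in (X <=
    _)%N]wm leqnn.
move=> i; apply: indA; rewrite AT ?inE //.
by rewrite -[RHS]cw; apply: eq_bigl => j; rewrite inE.
Qed.

(** The difference of the two sides is Heron's product (a + b + c)(a + b - c)(c + a - b)(c + b - a),
    whose first factor is positive. *)
Lemma heron_degenerate (F : realFieldType) (a b c : F) : 0 < a -> 0 < b -> 0 < c ->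
  (a ^+ 2 + a ^+ 2) * (b ^+ 2 + b ^+ 2) = (a ^+ 2 + b ^+ 2 - c ^+ 2) * (b ^+ 2 + a ^+ 2 - c ^+
      2) ->
  [\/ c = b + a, b = c + a | a = c + b].
Proof.
move=> a0 b0 c0 abc; have : (a + b + c) * ((b + a - c) * ((c + a - b) * (c + b - a))) = 0.
  by move/eqP: abc; rewrite -subr_eq0 => /eqP <-; ring.
move/eqP; rewrite !mulf_eq0 gt_eqF ?addr_gt0 //= !subr_eq0.
by case/or3P => /eqP->; [apply: Or31 | apply: Or32 | apply: Or33].
Qed.

Lemma joins_inj n (u v u' v' : 'I_n) e : joins u v =1 pred1 e -> joins u' v' =1 pred1 e ->
  (u', v') = (u, v) \/ (u', v') = (v, u).
Proof.
move=> /(_ e) + /(_ e); rewrite /= eqxx /joins => /orP[]/eqP-> /orP[]/eqP[-> ->]; by [left |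
    right].
Qed.

Section Reconstruction.
Variables (R : realType) (d n : nat) (w : 'rV[R[i]]_('C(d.+4, 2))) (p : 'M[R]_(n, d.+2))
  (E : 'M[rat]_('C(d.+4, 2), 'C(n, 2))).
Hypothesis dn : (d.+4 <= n)%N.
Hypothesis w_rank : rational_rank w = 'C(d.+4, 2).
Hypothesis wL : L_variety d.+2 w.
Hypothesis genp : generic_config p \/ generic_in_L d.+2 (map_mx (real_complex R) (lengths p)).
Hypothesis E0 : forall i e, 0 <= E i e.
Hypothesis wE : w = map_mx (real_complex R) (lengths p *m (map_mx ratr E)^T).

Let ER : 'M[R]_('C(d.+4, 2), 'C(n, 2)) := map_mx ratr E.

Lemma parity_part_gram_poly S (q : 'M[R]_(n, d.+2)) : (forall e, 0 < sqlengths q 0 e) ->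
  mmap ratr (sqlengths q 0) (parity_part S (gram_poly E)) = 0.
Proof.
have detw := det_gram_L_variety wL; case: genp => gen q0.
  apply: (parity_part_generic_config gen).
  rewrite mmap_gram_poly; apply: (fmorph_inj (real_complex R)).
  rewrite rmorph0 -det_map_mx map_gram -detw wE; congr (\det (gram _)).
  by apply/rowP => i; rewrite /sqr_mx !mxE /= rmorphXn.
apply: (parity_part_generic_in_L _ gen) => //.
rewrite rat_evalE mmap_gram_poly -[RHS]detw wE; congr (\det (gram _)).
rewrite map_mxM /sqr_mx; congr (map_mx _ (_ *m _)).
by apply/matrixP => i j; rewrite !mxE fmorph_rat.
Qed.

(** A rational relation between the rows of [E] is a rational relation between the entries of [w],
    which the rank excludes. *)
Lemma E_row_free : row_free E.
Proof.
apply: inj_row_free => c cE; apply/rowP => i; rewrite mxE.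
apply: (rational_rank_full w_rank) => {i}.
have : (map_mx ratr (c *m E) : 'rV[R]_ _) *m (lengths p)^T = 0 by rewrite cE map_mx0 mul0mx.
rewrite map_mxM -mulmxA -[map_mx _ E]trmxK -trmx_mul => /matrixP/(_ 0 0).
rewrite !mxE => /(congr1 (real_complex R)); rewrite rmorph0 rmorph_sum => cw.
rewrite -[RHS]cw; apply: eq_bigr => i _.
by rewrite rmorphM /= [w]wE [X in _ * X]mxE [X in _ = X%:C * _]mxE [X in _ = _ * X%:C]mxE
    fmorph_rat.
Qed.

(** A rational right inverse of [E] remains one over the reals. *)
Lemma rows_lin_indep (c : 'I_'C(d.+4, 2) -> R) : \sum_i c i *: row i ER = 0 -> forall i, c i = 0.
Proof.
move=> cE; have /row_freeP[B EB] := E_row_free.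
move=> i; have : (\row_i c i) *m ER = 0.
  by rewrite mulmx_sum_row -[RHS]cE; apply: eq_bigr => j _; rewrite mxE.
move=> /(congr1 (mulmx^~ (map_mx ratr B))); rewrite -mulmxA -map_mxM EB map_mx1 mulmx1 mul0mx.
by move=> /rowP/(_ i); rewrite !mxE.
Qed.

Lemma ER_ge0 i e : 0 <= ER i e.
Proof. by rewrite mxE ler0q. Qed.

Lemma row_ER_neq0 i : row i ER != 0.
Proof.
apply/negP => /eqP rowE; have := @rows_lin_indep (fun j => (j == i)%:R).
move=> /(_ _ i) H; have : (1 : R) = 0; last by move/eqP; rewrite oner_eq0.
rewrite -[LHS]/(true%:R) -(eqxx i) H // (bigD1 i) //= eqxx scale1r rowE add0r.
by apply: big1 => j /negPf ->; rewrite scale0r.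
Qed.

Lemma row_ER_neqD i j k : i != j -> i != k -> row i ER != row j ER + row k ER.
Proof.
move=> ij ik; apply/negP => /eqP rowE.
have := @rows_lin_indep (fun l => (l == i)%:R - (l == j)%:R - (l == k)%:R) _ i.
rewrite eqxx (negPf ij) (negPf ik) !subr0 => H.
suff /eqP : (1 : R) = 0 by rewrite oner_eq0.
have sumE l : \sum_m (m == l)%:R *: row m ER = row l ER.
  rewrite (bigD1 l) //= eqxx scale1r big1 ?addr0 // => m /negPf ->.
  by rewrite scale0r.
apply: H; under eq_bigr => l _ do rewrite !scalerBl.
by rewrite !sumrB !sumE rowE -addrA -opprD subrr.
Qed.

Lemma row_ER_inj i j : row i ER = row j ER -> i = j.
Proof.
move=> rowE; apply/eqP/negPn/negP => ij.
have := @rows_lin_indep (fun l => (l == i)%:R - (l == j)%:R) _ i.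
rewrite eqxx (negPf ij) subr0 => H.
suff /eqP : (1 : R) = 0 by rewrite oner_eq0.
have sumE l : \sum_m (m == l)%:R *: row m ER = row l ER.
  rewrite (bigD1 l) //= eqxx scale1r big1 ?addr0 // => m /negPf ->.
  by rewrite scale0r.
apply: H; under eq_bigr => l _ do rewrite scalerBl.
by rewrite sumrB !sumE rowE subrr.
Qed.

(** The points of [xi] are distinct, so all line lengths are positive, and so are their images under
    the nonnegative nonzero rows of E. The 2-minor at j and k given by [gram_minor] involves just
    the triangle 0jk, and Heron's formula makes it degenerate. *)
Lemma collinear_rows (j k : 'I_d.+3) e0j e0k ejk : j != k ->
  joins ord0 (lift ord0 j) =1 pred1 e0j -> joins ord0 (lift ord0 k) =1 pred1 e0k ->
  joins (lift ord0 j) (lift ord0 k) =1 pred1 ejk ->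
  collinear_triple (row ejk ER) (row e0k ER) (row e0j ER).
Proof.
move=> jk J0j J0k Jjk xi xi_inj; have /row_freeP[B EB] := E_row_free.
pose x0 : 'rV[R]_'C(n, 2) := \row_e `|xi (pair_of e).1 - xi (pair_of e).2|.
pose xc : 'cV[R]_n := \col_z xi z.
have xc0 e : 0 < sqlengths xc 0 e.
  rewrite mxE big_ord1 !mxE exprn_even_gt0 //= subr_eq0 (inj_eq xi_inj).
  exact: pair_of_neq.
have x0E : sqr_mx x0 = sqlengths xc.
  by apply/rowP => e; rewrite /sqr_mx !mxE big_ord1 !mxE real_normK ?num_real.
have wi i : (x0 *m ER^T) 0 i = line_length (row i ER) xi.
  by rewrite mxE; apply: eq_bigr => e _; rewrite mulrC mxE [in RHS]mxE [x0 _ _]mxE.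
have wi_gt0 i : 0 < line_length (row i ER) xi.
  have [e Ee] := rV0Pn _ (row_ER_neq0 i); rewrite mxE in Ee.
  rewrite lt_def sumr_ge0 => [|e' _]; last by rewrite mxE mulr_ge0 ?ER_ge0.
  rewrite andbT psumr_neq0 => [|e' _]; last by rewrite mxE mulr_ge0 ?ER_ge0.
  apply/hasP; exists e; rewrite ?mem_index_enum //= mxE mulr_gt0 ?lt_def ?Ee ?ER_ge0 //.
  by rewrite normr_eq0 normr_ge0 subr_eq0 (inj_eq xi_inj) pair_of_neq.
(* The parity decomposition of [gram_poly], evaluated on vectors of polynomials, is the expansion
   that [gram_minor] takes. *)
have detE (x : 'rV[{poly R}]_'C(n, 2)) :
    \det (gram (sqr_mx (x *m (map_mx polyC ER)^T))) = \sum_(S : {set 'I_'C(n, 2)})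
      (\prod_(i in S) x 0 i) *
      mmap polyC (sqr_mx x 0) (map_mpoly ratr (parity_part S (gram_poly E))).
  rewrite -map_mx_comp -(mmap_gram_poly (polyC \o ratr)) mmap_parity.
  apply: eq_bigr => S _; rewrite mmap_map_mpoly; congr (_ * _).
  by apply: eq_mmap => // e; rewrite mxE.
have psi0 S (q : 'M[R]_(n, d.+2)) : (forall e, 0 < sqlengths q 0 e) ->
    (map_mpoly ratr (parity_part S (gram_poly E))).@[sqlengths q 0] = 0.
  move=> /(parity_part_gram_poly S) <-.
  exact: (mmap_map_mpoly ratr (idfun : {rmorphism R -> R})).
have EF : ER *m map_mx ratr B = 1%:M by rewrite -map_mxM EB map_mx1.
have w0 i : (x0 *m ER^T) 0 i != 0 by rewrite wi gt_eqF.
have := gram_minor detE psi0 EF xc0 x0E w0 jk. cbv zeta.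
have sqE (x : 'rV[R]_'C(d.+4, 2)) e : sqr_mx x 0 e = x 0 e ^+ 2 by rewrite mxE.
rewrite !mxE !edge_at_diag !subr0 (edge_at_sym _ (lift ord0 k) (lift ord0 j)).
rewrite (edge_at_joins _ J0j) (edge_at_joins _ J0k) (edge_at_joins _ Jjk) !sqE !wi.
exact: heron_degenerate.
Qed.

Lemma reconstruction : exists T : 'I_d.+4 -> 'I_n, injective T /\ scaled_lengths w (rowsub T p).
Proof.
(* The entry of E at row uv and column xy. Applying [edge_at] in both places makes it total and
   symmetric in either pair. *)
pose W u v x y := edge_at (\row_i edge_at (row i ER) x y) u v.
have WE u v e x y : joins u v =1 pred1 e -> W u v x y = edge_at (row e ER) x y.
  by move=> Je; rewrite /W (edge_at_joins _ Je) mxE.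
have n4 : (4 <= n)%N by apply: leq_trans dn.
have row_ge0 i e : 0 <= row i ER 0 e by rewrite mxE ER_ge0.
have [||||T [s [T_inj s0 WT]]] := @relabelling R d.+3 n W.
- by [].
- by move=> u v x y; apply: edge_at_sym.
- move=> j k; rewrite /= !inE negb_or andbT => /andP[/andP[j0 k0] jk].
  case: (unliftP ord0 j) j0 jk => [{}j ->|->] // j0 jk.
  case: (unliftP ord0 k) k0 jk => [{}k ->|->] // k0 jk.
  have [e0j J0j] := ex_joins j0; have [e0k J0k] := ex_joins k0; have [ejk Jjk] := ex_joins jk.
  have jk' : j != k by apply: contraNneq jk => ->.
  have ne1 : ejk != e0k.
    apply/eqP => ee; rewrite ee in Jjk; case: (joins_inj J0k Jjk) => /eqP.
      by rewrite xpair_eqE eq_sym (negPf j0).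
    by rewrite xpair_eqE (eq_sym _ ord0) (negPf k0) andbF.
  have ne2 : ejk != e0j.
    apply/eqP => ee; rewrite ee in Jjk; case: (joins_inj J0j Jjk) => /eqP.
      by rewrite xpair_eqE eq_sym (negPf j0).
    by rewrite xpair_eqE (eq_sym _ ord0) (negPf k0) andbF.
  have ne3 : e0j != e0k.
    apply/eqP => ee; rewrite ee in J0j; case: (joins_inj J0j J0k) => /eqP.
      by rewrite xpair_eqE (eq_sym (lift _ k)) (negPf jk) andbF.
    by rewrite xpair_eqE (negPf j0).
  have tr : triple (edge_at (row ejk ER)) (edge_at (row e0k ER)) (edge_at (row e0j ER)).
    apply: triple_of_collinear => //; try exact: row_ER_neq0.
    - exact: collinear_rows J0j J0k Jjk.
    - exact: row_ER_neqD.
    - by apply: row_ER_neqD; rewrite eq_sym.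
    - by apply: row_ER_neqD => //; rewrite eq_sym.
  have [a [b [c [s [uabc s0 Ejk E0k E0j]]]]] := triple_classification n4 tr.
  exists a, b, c, s; split=> // x y; first by rewrite (WE _ _ _ _ _ Jjk).
    by rewrite (WE _ _ _ _ _ J0k).
  by rewrite (WE _ _ _ _ _ J0j).
- move=> u v u' v' uv uv' Wuv.
  have [e Je] := ex_joins uv; have [e' Je'] := ex_joins uv'.
  have ee' : e = e'.
    apply: row_ER_inj; apply/rowP => f; have := Wuv (pair_of f).1 (pair_of f).2.
    by rewrite (WE _ _ _ _ _ Je) (WE _ _ _ _ _ Je') !edge_at_pair_of.
  by rewrite ee' in Je; apply: joins_inj Je Je'.
exists T; split=> //; exists s => //; rewrite wE; congr (map_mx _ _); apply/rowP => e.
have Tne : T (pair_of e).1 != T (pair_of e).2 by rewrite (inj_eq T_inj) pair_of_neq.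
have [f Jf] := ex_joins Tne.
(* Row e of E is s times the unit vector at f, the image of the edge e under [T]. *)
have ERe f' : ER e f' = if f' == f then s else 0.
  have := WT _ _ (pair_of_neq e) (pair_of f').1 (pair_of f').2.
  rewrite (WE _ _ _ _ _ (joins_pair_of e)) edge_at_pair_of mxE => ->.
  have := Jf f'; rewrite /joins /indicator /= => <-; rewrite -!xpair_eqE.
  by rewrite -surjective_pairing.
rewrite [LHS]mxE (bigD1 f) //= big1 ?addr0 => [|f' /negPf f'f]; last first.
  by rewrite [X in _ * X]mxE ERe f'f mulr0.
rewrite [X in _ * X]mxE ERe eqxx mulrC [RHS]mxE; congr (_ * _); rewrite !mxE; congr Num.sqrt.
transitivity (sqlengths p 0 f); first by rewrite mxE.
rewrite -(edge_at_joins _ Jf) edge_at_sqlengths.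
by apply: eq_bigr => k _; rewrite !mxE.
Qed.

Lemma reconstruction_similar (T : 'I_d.+4 -> 'I_n) (q : 'M[R]_(d.+4, d.+2)) :
  scaled_lengths w (rowsub T p) -> scaled_lengths w q -> similar_configs (rowsub T p) q.
Proof.
move=> [s s0 ws] [t t0 wt]; apply: (@similar_of_lengths _ _ _ _ _ (s / t)); first exact: divr_gt0.
have /map_mx_inj st : map_mx (real_complex R) (t *: lengths q) =
    map_mx (real_complex R) (s *: lengths (rowsub T p)) by rewrite -ws -wt.
by rewrite mulrC -scalerA -st scalerA mulVf ?scale1r // gt_eqF.
Qed.

End Reconstruction.

Theorem theorem7p2 (R : realType) (d n : nat) (w : 'rV[R[i]]_('C(d.+2, 2)))
    (p : 'M[R]_(n, d)) (g : 'I_('C(d.+2, 2)) -> 'rV[rat]_('C(n, 2))) :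
  (2 <= d)%N ->
  (d.+2 <= n)%N ->
  rational_rank w = 'C(d.+2, 2) ->
  L_variety d w ->
  generic_config p \/ generic_in_L d (map_mx (real_complex R) (lengths p)) ->
  (forall i e, 0 <= g i 0 e) ->
  (forall i, w 0 i = (rat_functional (g i) p)%:C) ->
  exists T : 'I_d.+2 -> 'I_n,
    [/\ injective T,
        scaled_lengths w (rowsub T p) &
        forall q : 'M[R]_(d.+2, d),
          scaled_lengths w q -> similar_configs (rowsub T p) q].
Proof.
case: d w p g => [|[|d]] // w p g _ dn w_rank wL genp g0 wg.
pose E := \matrix_(i, e) g i 0 e.
have wE : w = map_mx (real_complex R) (lengths p *m (map_mx ratr E)^T).
  apply/rowP => i; rewrite wg [RHS]mxE; congr (_%:C); rewrite mxE.
  by apply: eq_bigr => e _; rewrite mulrC; congr (_ * _); rewrite !mxE.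
have E0 i e : 0 <= E i e by rewrite mxE.
have [T [T_inj wT]] := reconstruction dn w_rank wL genp E0 wE.
by exists T; split=> // q; apply: reconstruction_similar.
Qed.
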